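(* Suppose that $R=R_1\times R_2$, where, for $i=1,2$, $R_i$ is an Artinian local ring with exactly $t_i\geq 2$ proper ideals and $t_i$ is (finite and) even. Then $\mathcal{EG}(R)$ is Class $2$ if and only if $t_1=t_2=2$.
   Context: All rings are commutative with identity. Proper ideals of a ring are the ideals different from the whole ring; the zero ideal is counted as a proper ideal (so $R_i$ has $t_i+1$ ideals in total). $A(R)$ is the set of ideals of $R$ with non-zero annihilator, and $A(R)^*=A(R)\setminus\{(0)\}$. A non-zero ideal $I$ of $R$ is essential, written $I\leq_e R$, if it has non-zero intersection with every non-zero ideal of $R$. The essential annihilating-ideal graph $\mathcal{EG}(R)$ is the simple graph with vertex set $A(R)^*$ in which two distinct vertices $I,J$ are adjacent if and only if $\mathrm{Ann}(IJ)\leq_e R$. For a graph $G$, $\Delta(G)$ is the maximum degree and $\chi'(G)$ the edge chromatic number (smallest number of colors in an edge coloring in which adjacent edges get different colors). $G$ is Class $2$ if $\chi'(G)=\Delta(G)+1$. *)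

(* Defs.v *)
From HB Require Import structures.
From mathcomp Require Import all_boot all_order all_algebra.
From mathcomp Require Import boolp classical_sets functions cardinality.

Set Implicit Arguments.
Unset Strict Implicit.
Unset Printing Implicit Defensive.

Import GRing.Theory.

Local Open Scope classical_set_scope.
Local Open Scope card_scope.
Local Open Scope ring_scope.

(* Ideals are [set R] rather than boolean predicates, and [idealr_closed] and
   [proper_ideal] of ring_quotient are not used: they exclude the unit ideal,
   which is needed here. *)
Section Ideals.
Variable R : comNzRingType.
Implicit Types I J K M : set R.

Definition is_ideal I : Prop :=
  [/\ I 0, (forall x y, I x -> I y -> I (x + y))
    & (forall a x, I x -> I (a * x))].

Definition is_proper_ideal I : Prop := is_ideal I /\ I <> setT.

Definition is_maximal_ideal M : Prop :=
  is_proper_ideal M /\ forall J, is_proper_ideal J -> M `<=` J -> J = M.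

Definition ideal_mul I J : set R :=
  [set x | exists (n : nat) (a b : 'I_n -> R),
     [/\ forall i, I (a i), forall i, J (b i) & x = \sum_(i < n) a i * b i]].

Definition Ann I : set R := [set r | forall x, I x -> r * x = 0].

Definition essential I : Prop :=
  [/\ is_ideal I, I <> [set 0]
    & forall J, is_ideal J -> J <> [set 0] -> I `&` J <> [set 0]].

Definition annihilating_ideal I : Prop := is_ideal I /\ Ann I <> [set 0].

Lemma ideal_mulC I J : ideal_mul I J = ideal_mul J I.
Proof.
suff sub A B : ideal_mul A B `<=` ideal_mul B A by apply/seteqP; split.
move=> x [n [a [b [Aa Bb ->]]]]; exists n, b, a; split=> //.
by apply: eq_bigr => i _; rewrite mulrC.
Qed.

End Ideals.

Definition artinian (R : comNzRingType) : Prop :=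
  forall I : nat -> set R,
    (forall n, is_ideal (I n)) -> (forall n, I n.+1 `<=` I n) ->
    exists N : nat, forall n : nat, (N <= n)%N -> I n = I N.

Definition local_ring (R : comNzRingType) : Prop :=
  exists! M : set R, is_maximal_ideal M.

Record simple_graph (T : Type) := SimpleGraph {
  vertices : set T;
  adj : T -> T -> Prop;
  adj_vertices : forall x y, adj x y -> vertices x /\ vertices y;
  adj_sym : forall x y, adj x y -> adj y x;
  adj_irrefl : forall x, ~ adj x x
}.

Section Graphs.
Variables (T : Type) (G : simple_graph T).

Definition edges : set (set T) :=
  [set e | exists x y, adj G x y /\ e = [set x; y]].

Definition has_degree (x : T) (d : nat) : Prop := [set y | adj G x y] #= `I_d.

(* [is_max_degree d] and [is_edge_chromatic_number k] determine d and k
   uniquely; no value is assigned when the maximum or minimum does not exist. *)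
Definition is_max_degree (d : nat) : Prop :=
  (exists2 x, vertices G x & has_degree x d) /\
  (forall x, vertices G x -> exists2 m : nat, has_degree x m & (m <= d)%N).

Definition edge_coloring (k : nat) (c : set T -> nat) : Prop :=
  (forall e, edges e -> (c e < k)%N) /\
  (forall e f, edges e -> edges f -> e <> f -> e `&` f !=set0 -> c e <> c f).

Definition is_edge_chromatic_number (k : nat) : Prop :=
  (exists c, edge_coloring k c) /\
  (forall m : nat, (exists c, edge_coloring m c) -> (k <= m)%N).

Definition class2 : Prop :=
  exists d : nat, is_max_degree d /\ is_edge_chromatic_number d.+1.

End Graphs.

Section EssentialAnnihilatingIdealGraph.
Variable R : comNzRingType.

Definition EG_vertices : set (set R) :=
  [set I | annihilating_ideal I /\ I <> [set 0]].

Definition EG_adj (I J : set R) : Prop :=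
  [/\ EG_vertices I, EG_vertices J, I <> J & essential (Ann (ideal_mul I J))].

Lemma EG_adj_vertices I J : EG_adj I J -> EG_vertices I /\ EG_vertices J.
Proof. by case. Qed.

Lemma EG_adj_sym I J : EG_adj I J -> EG_adj J I.
Proof. by case=> vI vJ neq ess; split=> // [/esym //|]; rewrite ideal_mulC. Qed.

Lemma EG_adj_irrefl I : ~ EG_adj I I.
Proof. by case. Qed.

Definition EG : simple_graph (set R) :=
  SimpleGraph EG_adj_vertices EG_adj_sym EG_adj_irrefl.

End EssentialAnnihilatingIdealGraph.

(* Main.v *)
From mathcomp Require Import all_boot.
From mathcomp Require Import perm zify.

Set Implicit Arguments.
Unset Strict Implicit.
Unset Printing Implicit Defensive.

(** In a local ring with finitely many ideals, not a field, [Ann K] is essential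
    exactly when [K] is proper. Hence in R1 x R2 two vertices are adjacent unless both
    have first component R1 or both have second component R2: the graph is K_n with
    the edges of two disjoint cliques removed, on A = {R1 x I2} and B = {I1 x R2},
    of sizes a = t2 and b = t1, where n = (a+1)(b+1)-2 is odd and Delta = n-1.

    A colour class of a graph of odd order misses a vertex; for a = b = 2 the missing
    incidences number only 4, fewer than the 6 colours, so the graph is Class 2.

    Otherwise let a <= b and let x = n - b. The vertices outside B are properly
    coloured with N = n - 1 colours so that each of them misses exactly b colours.
    If every colour is missed by at most b of them, Koenig's theorem decomposes the
    relation "u misses i" into b matchings, which colour the edges at the b vertices
    of B. To get this balance, start from the colouring of K_x by sums modulo x,
    delete a few edges inside A and add a vertex "infinity" joined to A so that it
    absorbs one missing incidence in each of 3a - 2 colours; then even out the colour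
    classes, including the vertex at infinity, by Kempe exchanges. *)

(** * Families of involutions and Kempe exchanges *)

Section Involutions.
Variable V : finType.
Implicit Types (f g : V -> V) (u v w : V) (T : {set V}).

Definition fixpts f : {set V} := [set v | f v == v].

Definition stable f T := forall v, v \in T -> f v \in T.

Lemma stableE f T v : involutive f -> stable f T -> (f v \in T) = (v \in T).
Proof. by move=> fK st; apply/idP/idP => [/st|/st //]; rewrite fK. Qed.

(** The moved points split into two sets exchanged by [f]: those ranked before their image and those
    ranked after it. *)
Lemma odd_fixpts f : involutive f -> odd #|fixpts f| = odd #|V|.
Proof.
move=> fK; pose r v := enum_rank v.
pose L := [set v | r v < r (f v)]; pose G := [set v | r (f v) < r v].
have cLG : #|L| = #|G|.
  have -> : G = f @: L.
    apply/setP => v; apply/idP/imsetP => [Gv|[w Lw ->]].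
      by exists (f v); rewrite ?fK // inE fK; move: Gv; rewrite inE.
    by move: Lw; rewrite !inE fK.
  by rewrite card_imset //; apply: inv_inj.
have FLG : ~: fixpts f = L :|: G.
  apply/setP => v; rewrite !inE -neq_ltn; congr (~~ _).
  apply/eqP/eqP => [->//|/val_inj/enum_rank_inj fv]; by rewrite -fv.
have dLG : [disjoint L & G].
  by rewrite -setI_eq0; apply/eqP/setP => w; rewrite !inE; case: ltngtP.
have := cardsC (fixpts f); rewrite FLG cardsU disjoint_setI0 // cards0 subn0 -cLG => <-.
by rewrite addnn oddD odd_double addbF.
Qed.

(* The alternating path from [u]: the orbit of [u] under [g \o f], on which the
   point of index [k] is sent by [g] and [f] to those of index [- k] and
   [- k - 1] modulo the order of the orbit. *)
Lemma kempe_chain f g u : involutive f -> involutive g -> g u = u ->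
  exists T, [/\ u \in T, stable f T, stable g T,
    forall U, stable f U -> stable g U -> u \in U -> T \subset U &
    (exists w, [/\ fixpts f :&: T = [set w], fixpts g :&: T = [set u] &
       forall s : V -> bool, (forall v, f v != v -> s (f v) != s v) ->
         (forall v, g v != v -> s (g v) != s v) -> s w = s u]) \/
    (fixpts f :&: T = set0 /\ #|fixpts g :&: T| = 2)].
Proof.
move=> fK gK gu; pose h := g \o f.
have h_inj : injective h by apply: inj_comp; apply: inv_inj.
pose m := order h u; pose p k := iter k h u.
have m_gt0 : 0 < m by apply: order_gt0.
have pm : p m = u by apply: iter_order.
have p_inj j k : j < m -> k < m -> (p j == p k) = (j == k).
  move=> jm km; rewrite /p -(nth_traject h jm u) -(nth_traject h km u).
  rewrite -[traject h u m]/(orbit h u).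
  by rewrite nth_uniq ?size_orbit ?orbit_uniq.
have gp k : k <= m -> g (p k) = p (m - k).
  elim: k => [_|k IH km]; first by rewrite subn0 pm.
  have := IH (ltnW km); have -> : m - k = (m - k.+1).+1 by lia.
  by move=> /(inv_inj gK) e; rewrite /p iterS /= gK -/(p k) e fK.
have fp k : k < m -> f (p k) = p (m - k.+1).
  by move=> km; rewrite -gp // /p iterS /= gK.
pose T := [set v in orbit h u].
have TP v : reflect (exists2 k, k < m & v = p k) (v \in T).
  rewrite inE; apply: (iffP trajectP) => [] [k km ->]; by exists k.
have pT k : k < m -> p k \in T by move=> km; apply/TP; exists k.
have uT : u \in T by apply: (pT 0).
have fixf k : k < m -> (f (p k) == p k) = (k.*2.+1 == m).
  by move=> km; rewrite fp // p_inj //; lia.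
have fixg k : 0 < k < m -> (g (p k) == p k) = (k.*2 == m).
  by move=> /andP[k0 km]; rewrite gp ?(ltnW km) // p_inj //; lia.
exists T; split=> //.
- by move=> _ /TP[k km ->]; rewrite fp //; apply: pT; lia.
- move=> _ /TP[[|k] km ->]; first by rewrite gu.
  by rewrite gp ?(ltnW km) //; apply: pT; lia.
- move=> U fU gU uU; apply/subsetP => _ /TP[k _ ->].
  by elim: k => // k IH; apply/gU/fU.
(* A fixed point of [f] has an index with [2k + 1 = m], and one of [g] other than [u] has [2k = m].
   The parity of [m] therefore decides between one fixed point of each and two of [g]. *)
have [odm|evm] := boolP (odd m); [left|right].
  exists (p m./2); split.
  - apply/setP => v; rewrite !inE; apply/andP/eqP => [[/[swap]]|->].
      by move=> /trajectP[k km ->]; rewrite fixf // => /eqP e; congr p; lia.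
    by split; [rewrite fixf; lia|have := pT m./2; rewrite inE; apply; lia].
  - apply/setP => v; rewrite !inE; apply/andP/eqP => [[/[swap]]|->].
      move=> /trajectP[[|k] km -> //]; rewrite -/(p k.+1) fixg // => /eqP e.
      by move: odm; rewrite -e odd_double.
    by rewrite gu; move: uT; rewrite inE.
  (* Before index [m./2] both involutions move the points they are applied to, so each step of [h]
     flips [s] twice. *)
  move=> s sf sg; have: m./2 <= m./2 by []. 
  elim: {1 3}m./2 => // k IH km; rewrite -IH ?(ltnW km) //.
  have km' : k < m by lia.
  have fN : f (p k) != p k by rewrite fixf; lia.
  have gN : g (f (p k)) != f (p k).
    by rewrite fp // fixg; lia.
  have := sf _ fN; have := sg _ gN.
  rewrite [p k.+1]/p iterS /= -/(p k).
  by do 3 case: (s _).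
split.
  apply/setP => v; rewrite !inE; apply/andP => [[/[swap]]].
  by move=> /trajectP[k km ->]; rewrite fixf // => /eqP e; move: evm; rewrite -e /= odd_double.
have -> : fixpts g :&: T = [set u; p m./2].
  apply/setP => v; rewrite !inE; apply/andP/orP => [[/[swap]]|].
    move=> /trajectP[[|k] km ->]; first by left.
    by rewrite -/(p k.+1) fixg // => /eqP e; right; apply/eqP; congr p; lia.
  case=> /eqP ->; first by rewrite gu; move: uT; rewrite inE.
  split; first by rewrite fixg; lia.
  by have := pT m./2; rewrite inE; apply; lia.
rewrite cards2 -[u in u != _]/(p 0) p_inj; lia.
Qed.

End Involutions.

Section InvolutionFamilies.
Variables V I : finType.
Implicit Types (f : I -> V -> V) (u v w : V) (T : {set V}) (i j k : I).

(* A family of involutions encodes an edge-coloured loopless multigraph: [u] and [v <> u]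
   are joined by an edge of colour [k] when [f k u = v], and [u] misses the
   colour [k] when [f k u = u]. *)
Definition mult f u v := #|[set k | f k u == v]|.

Lemma sum_mult f u : \sum_v mult f u v = #|I|.
Proof.
rewrite -sum1_card (partition_big (f^~ u) xpredT) //=.
by apply: eq_bigr => v _; rewrite /mult -sum1dep_card.
Qed.

Lemma sum_fixpts f : \sum_k #|fixpts (f k)| = \sum_v mult f v v.
Proof.
transitivity (\sum_k \sum_v (f k v == v : nat)).
  apply: eq_bigr => k _; rewrite /fixpts -sum1dep_card [LHS]big_mkcond;
  by apply: eq_bigr => v _; case: eqP.
rewrite exchange_big; apply: eq_bigr => v _.
by rewrite /mult -sum1dep_card [RHS]big_mkcond; apply: eq_bigr => k _; case: eqP.
Qed.

(** A Kempe exchange. [T] is meant to be a union of chains in the colours [i] and [j], that is,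
    stable under [f i] and [f j]. *)
Definition swap T i j f k v := f (if v \in T then tperm i j k else k) v.

(** At each vertex the exchange only permutes the colours, so the underlying multigraph is
    preserved. *)
Lemma mult_swap T i j f u v : mult (swap T i j f) u v = mult f u v.
Proof.
rewrite /mult /swap; case: (u \in T) => //.
rewrite -(card_imset _ (@perm_inj _ (tperm i j))); congr #|pred_of_set _|.
apply/setP => k; rewrite inE; apply/imsetP/idP => [[l + ->]|fk].
  by rewrite inE.
by exists (tperm i j k); rewrite ?inE tpermK.
Qed.

Lemma swap_invol T i j f : (forall k, involutive (f k)) ->
  stable (f i) T -> stable (f j) T -> forall k, involutive (swap T i j f k).
Proof.
move=> fK si sj k v; rewrite /swap.
have tr l (b : bool) : f (if b then l else l) v = f l v by case: b.
have [vT|vT] := boolP (v \in T); case: tpermP => [->|->|/eqP ki /eqP kj].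
- by rewrite sj // fK.
- by rewrite si // fK.
- by case: ifP => _; rewrite ?(tpermD, fK) // eq_sym.
- by rewrite stableE // (negbTE vT) fK.
- by rewrite stableE // (negbTE vT) fK.
- by case: ifP => _; rewrite ?(tpermD, fK) // eq_sym.
Qed.

Lemma swap_fixptsl T i j f :
  #|fixpts (swap T i j f i)| = #|fixpts (f i) :\: T| + #|fixpts (f j) :&: T|.
Proof.
rewrite -(cardsID T) addnC; congr (_ + _); apply: eq_card => v;
  by rewrite !inE /swap ?tpermL; case: (v \in T); rewrite ?andbF.
Qed.

Lemma swap_fixptsr T i j f :
  #|fixpts (swap T i j f j)| = #|fixpts (f j) :\: T| + #|fixpts (f i) :&: T|.
Proof.
rewrite -(cardsID T) addnC; congr (_ + _); apply: eq_card => v;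
  by rewrite !inE /swap ?tpermR; case: (v \in T); rewrite ?andbF.
Qed.

Lemma swap_fixptsD T i j f k : k != i -> k != j ->
  fixpts (swap T i j f k) = fixpts (f k).
Proof.
move=> ki kj; apply/setP => v; rewrite !inE /swap tpermD 1?eq_sym //.
by case: ifP.
Qed.

End InvolutionFamilies.

(** Induction on a stable set [U] in which [g] has more fixed points than [f]. The chain of a fixed
    point of [g] either is the required set or contains one fixed point of each; in the second case
    it can be removed from [U] without changing the difference. *)
Lemma kempe_balance (V : finType) (f g : V -> V) :
  involutive f -> involutive g -> #|fixpts f| < #|fixpts g| ->
  exists T, [/\ stable f T, stable g T, fixpts f :&: T = set0 &
    #|fixpts g :&: T| = 2].
Proof.
move=> fK gK lt_fg.
have {lt_fg}: #|fixpts f :&: setT| < #|fixpts g :&: setT| by rewrite !setIT.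
have: stable f setT by []. have: stable g setT by [].
move: {2}#|_|.+1 (ltnSn #|[set: V]|) => n.
elim: n [set: V] => // n IH U Un gU fU ltfg.
have [u] : exists u, u \in fixpts g :&: U.
  by apply/set0Pn; rewrite -card_gt0; apply: leq_ltn_trans ltfg.
rewrite !inE => /andP[/eqP gu uU].
have [T [uT fT gT minT [[w [fw gw _]]|[f0 g2]]]] := kempe_chain fK gK gu; last first.
  by exists T.
have /setIidPr TU := minT U fU gU uU.
have fUT : stable f (U :\: T) by move=> v; rewrite !inE !stableE.
have gUT : stable g (U :\: T) by move=> v; rewrite !inE !stableE.
apply: IH fUT _ => //.
  rewrite -ltnS; apply: leq_trans Un; rewrite ltnS; apply: proper_card.
  apply/properP; split; first exact: subsetDl.
  by exists u => //; rewrite inE uT.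
have cardU h v : fixpts h :&: T = [set v] ->
    #|fixpts h :&: U| = #|fixpts h :&: (U :\: T)|.+1.
  by move=> hT; rewrite -(cardsID T) setIDA -setIA TU hT cards1.
by move: ltfg; rewrite (cardU _ _ fw) (cardU _ _ gw) ltnS.
Qed.

(** If colour [i] has more than [K] fixed points, the bound on the sum gives a colour [j] with fewer
    than [K], hence by parity at most [K - 2]. An exchange moves two fixed points from [i] to [j]:
    the total excess over [K] drops and [j] stays within the bound. *)
Lemma equalize (V I : finType) (f : I -> V -> V) (K : nat) :
  (forall k, involutive (f k)) -> odd K = odd #|V| ->
  \sum_k #|fixpts (f k)| <= #|I| * K ->
  exists f' : I -> V -> V, [/\ forall k, involutive (f' k), mult f' =2 mult f &
    forall k, #|fixpts (f' k)| <= K].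
Proof.
move=> fK oddK; pose excess f := \sum_(k : I) (#|fixpts (f k : V -> V)| - K).
move: {2}(excess f).+1 (ltnSn (excess f)) => n.
elim: n f fK => // n IH f fK ltn sumK.
have [/forallP leK|] := boolP [forall k, #|fixpts (f k)| <= K]; first by exists f.
rewrite negb_forall => /existsP[i]; rewrite -ltnNge => ltKi.
have par k : odd #|fixpts (f k)| = odd K by rewrite odd_fixpts.
have [j ltjK] : exists j, #|fixpts (f j)| < K.
  apply/existsP; apply: contraLR sumK; rewrite negb_exists => /forallP leK.
  rewrite -ltnNge -sum_nat_const (bigD1 i) //= [X in _ < X](bigD1 i) //=.
  rewrite -addSn; apply: leq_add => //; apply: leq_sum => k _.
  by have := leK k; rewrite -leqNgt.
have [T [sj si T0 T2]] := kempe_balance (fK j) (fK i) (ltn_trans ltjK ltKi).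
have neq_ij : i != j by apply: contraTneq ltKi => ->; rewrite -leqNgt ltnW.
have cT h : #|fixpts h :\: T| = #|fixpts h| - #|fixpts h :&: T|.
  by rewrite cardsD.
have fi := swap_fixptsl T i j f; have fj := swap_fixptsr T i j f.
rewrite !cT T0 T2 cards0 addn0 subn0 in fi fj.
have pi := par i; have pj := par j.
have [|||f' [f'K mf' leK]] := IH (swap T i j f).
- exact: swap_invol.
- rewrite -ltnS; apply: leq_trans ltn; rewrite ltnS /excess (bigD1 i) //= [X in _ < X](bigD1 i) //=.
  rewrite -addSn; apply: leq_add; first by rewrite fi; lia.
  rewrite (bigD1 j) 1?eq_sym //= [X in _ <= X](bigD1 j) 1?eq_sym //=.
  apply: leq_add; first by rewrite fj; lia.
  by apply: leq_sum => k /andP[ki kj]; rewrite swap_fixptsD.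
- rewrite sum_fixpts; under eq_bigr do rewrite mult_swap.
  by rewrite -sum_fixpts.
by exists f'; split=> // u v; rewrite mf' mult_swap.
Qed.

(** * Koenig's edge-colouring theorem for bipartite graphs *)

Section BipartiteEdgeColoring.
Variables (V I : finType) (s : V -> bool).
Implicit Types f : I -> V -> V.

Definition crossing f := forall k v, f k v != v -> s (f k v) != s v.

Lemma crossing_mult0 f u v : crossing f -> u != v -> s u = s v -> mult f u v = 0.
Proof.
move=> cf uv suv; apply/eqP; rewrite cards_eq0; apply/eqP/setP => k.
rewrite !inE; apply/eqP => fkv.
by have := cf k u; rewrite fkv eq_sym uv suv eqxx => /(_ isT).
Qed.

(** With [i] missed at [u] and [j] missed at [v], exchanging [i] and [j] on the chain from [u] makes
    [j] missed at both ends, ready for the new edge. *)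
Lemma add_edge f u v : (forall k, involutive (f k)) -> crossing f ->
  s u != s v -> 0 < mult f u u -> 0 < mult f v v ->
  exists f' : I -> V -> V, [/\ forall k, involutive (f' k), crossing f' &
    forall p q, p != q ->
      mult f' p q = mult f p q + (((p, q) == (u, v)) || ((p, q) == (v, u)))].
Proof.
move=> fK cf suv /card_gt0P[i] /[!inE] /eqP fiu /card_gt0P[j] /[!inE] /eqP fjv.
have uv : u != v by apply: contraNneq suv => ->.
have [T [uT sj si _ alt]] := kempe_chain (fK j) (fK i) fiu.
(* As [v] misses [j], it could only be the other end [w] of the chain; but [w] lies on the side of
   [u]. *)
have vT : v \notin T.
  have vj : v \in fixpts (f j) by rewrite inE fjv.
  apply/negP => vT; case: alt => [[w [fw _ sw]]|[f0 _]].
    have : v \in fixpts (f j) :&: T by rewrite inE vj.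
    rewrite fw inE => /eqP vw; move: suv; rewrite vw (sw s) ?eqxx //; exact: cf.
  by have : v \in fixpts (f j) :&: T; [rewrite inE vj|rewrite f0 inE].
pose g := swap T i j f.
have gK : forall k, involutive (g k) by apply: swap_invol.
have cg : crossing g by move=> k w; apply: cf.
have gu : g j u = u by rewrite /g /swap uT tpermR.
have gv : g j v = v by rewrite /g /swap (negbTE vT).
pose f' k p := if k == j then if p == u then v else if p == v then u else g j p else g k p.
have gjN p : p != u -> p != v -> (g j p != u) && (g j p != v).
  move=> pu pv; apply/andP; split; [apply: contraNneq pu|apply: contraNneq pv] => e.
    by rewrite -(gK j p) e gu.
  by rewrite -(gK j p) e gv.
exists f'; split.
- move=> k p; rewrite /f'; case: (k =P j) => [_|_]; last exact: gK.
  have [->|pu] := eqVneq p u; first by rewrite eqxx eq_sym (negbTE uv).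
  have [->|pv] := eqVneq p v; first by rewrite eqxx.
  by have /andP[/negbTE-> /negbTE->] := gjN p pu pv; rewrite gK.
- move=> k p; rewrite /f'; case: (k =P j) => [_|_]; last exact: cg.
  have [->|pu] := eqVneq p u; first by move=> _; rewrite eq_sym.
  by have [->|pv] := eqVneq p v; [|apply: cg].
move=> p q pq; rewrite -(mult_swap T i j f) -/g /mult.
rewrite (cardsD1 j) [in RHS](cardsD1 j) !inE.
have -> : [set k | f' k p == q] :\ j = [set k | g k p == q] :\ j.
  by apply/setP => k; rewrite !inE /f'; case: (k == j).
rewrite addnAC; congr (_ + _); rewrite /f' eqxx !xpair_eqE.
have [pu|pu] := eqVneq p u.
  by rewrite pu in pq *; rewrite gu (negbTE pq) (negbTE uv) /= orbF eq_sym.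
have [pv|pv] := eqVneq p v.
  by rewrite pv in pq *; rewrite gv (negbTE pq) /= eq_sym.
by rewrite /= addn0.
Qed.

End BipartiteEdgeColoring.

(** Induction on the number of edges: remove one, colour the rest, and put it back with
    [add_edge]. *)
Lemma konig (X Y I : finType) (E : {set X * Y}) :
  (forall x, #|[set y | (x, y) \in E]| <= #|I|) ->
  (forall y, #|[set x | (x, y) \in E]| <= #|I|) ->
  exists f : I -> X + Y -> X + Y,
    [/\ forall k, involutive (f k),
        forall x x', x != x' -> mult f (inl x) (inl x') = 0,
        forall y y', y != y' -> mult f (inr y) (inr y') = 0 &
        forall x y, mult f (inl x) (inr y) = ((x, y) \in E)].
Proof.
pose s (v : X + Y) := if v is inl _ then true else false.
(* The induction also records the multiplicities read from the side of [Y], and that every edge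
   crosses. *)
suff main : (forall x, #|[set y | (x, y) \in E]| <= #|I|) ->
  (forall y, #|[set x | (x, y) \in E]| <= #|I|) ->
  exists f : I -> X + Y -> X + Y, [/\ forall k, involutive (f k), crossing s f,
     forall x y, mult f (inl x) (inr y) = ((x, y) \in E) &
     forall x y, mult f (inr y) (inl x) = ((x, y) \in E)].
  move=> rowE colE; have [f [fK cf fE _]] := main rowE colE.
  by exists f; split=> // [x x' xx'|y y' yy']; apply: (crossing_mult0 (s := s)).
move: {2}#|E|.+1 (ltnSn #|E|) => n; elim: n E => // n IH E En rowE colE.
have [->|/set0Pn[[x y] xyE]] := eqVneq E set0.
  exists (fun _ => id); split=> // [k v|x y|x y]; rewrite ?eqxx // in_set0; apply/eqP;
    by rewrite cards_eq0; apply/eqP/setP => k; rewrite !inE.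
pose E' := E :\ (x, y).
have [||| f [fK cf fE fE']] := IH E'.
- by rewrite -ltnS; apply: leq_trans En; rewrite ltnS [X in _ < X](cardsD1 (x, y)) xyE.
- move=> p; apply: leq_trans (rowE p); apply/subset_leq_card/subsetP => q.
  by rewrite !inE => /andP[].
- move=> p; apply: leq_trans (colE p); apply/subset_leq_card/subsetP => q.
  by rewrite !inE => /andP[].
(* Without the edge [(x, y)] the degree of [x] is below the number of colours, so some colour fixes
   [x]. *)
have missx : 0 < mult f (inl x) (inl x).
  rewrite lt0n; apply: contraTneq isT => mult0.
  have := sum_mult f (inl x); rewrite (bigD1 (inl x)) //= mult0 add0n => sumI.
  suff : \sum_(v | v != inl x) mult f (inl x) v < #|I| by rewrite sumI ltnn.
  apply: leq_trans (rowE x); rewrite (cardsD1 y) inE xyE ltnS.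
  rewrite big_sumType /= big1 ?add0n; last first.
    by move=> p px; apply: (crossing_mult0 (s := s)); rewrite 1?eq_sym.
  rewrite -sum1dep_card big_mkcond /=  [X in _ <= X]big_mkcond /=.
  by apply: leq_sum => q _; rewrite fE !inE xpair_eqE eqxx; case: eqP.
have missy : 0 < mult f (inr y) (inr y).
  rewrite lt0n; apply: contraTneq isT => mult0.
  have := sum_mult f (inr y); rewrite (bigD1 (inr y)) //= mult0 add0n => sumI.
  suff : \sum_(v | v != inr y) mult f (inr y) v < #|I| by rewrite sumI ltnn.
  apply: leq_trans (colE y); rewrite (cardsD1 x) inE xyE ltnS.
  rewrite big_sumType /= [X in _ + X]big1 ?addn0; last first.
    by move=> p px; apply: (crossing_mult0 (s := s)); rewrite 1?eq_sym.
  rewrite -sum1dep_card big_mkcond /=  [X in _ <= X]big_mkcond /=.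
  by apply: leq_sum => q _; rewrite fE' !inE xpair_eqE eqxx andbT; case: eqP.
have [//|f' [f'K cf' mf']] := add_edge fK cf _ missx missy.
have inE' p q : ((p, q) \in E) = ((p, q) \in E') + ((p, q) == (x, y)) :> nat.
  rewrite in_setD1; have [->|] := eqVneq (p, q) (x, y); by rewrite ?xyE /= ?addn0.
exists f'; split=> // p q; rewrite mf' // inE' ?fE ?fE' !xpair_eqE /=.
  by rewrite orbF.
by rewrite andbC.
Qed.

(** * Colouring the multipartite graph *)

(** Together with [card_ord_inj], this reduces counting colours to arithmetic on an explicit list
    [phi 0, ..., phi n.-1]. *)
Lemma card_ord_surj n N (P : pred nat) (phi : nat -> nat) :
  (forall i, i < N -> P i -> exists2 j, j < n & i = phi j) ->
  #|[set i : 'I_N | P i]| <= n.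
Proof.
move=> surj; have := size_map phi (iota 0 n); rewrite size_iota => <-.
rewrite cardE -(size_map val); apply: uniq_leq_size.
  by rewrite (map_inj_uniq val_inj) enum_uniq.
move=> _ /mapP[i + ->]; rewrite mem_enum inE => /(surj _ (ltn_ord i))[j jn ij].
by rewrite /= ij map_f // mem_iota.
Qed.

Lemma card_ord_inj n N (P : pred nat) (phi : nat -> nat) :
  (forall j, j < n -> phi j < N /\ P (phi j)) ->
  (forall j k, j < n -> k < n -> phi j = phi k -> j = k) ->
  n <= #|[set i : 'I_N | P i]|.
Proof.
move=> phiP phiI; have := size_map phi (iota 0 n); rewrite size_iota => <-.
rewrite cardE -(size_map val); apply: uniq_leq_size.
  rewrite map_inj_in_uniq ?iota_uniq // => j k; rewrite !mem_iota /=.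
  exact: phiI.
move=> _ /mapP[j + ->]; rewrite mem_iota /= => /phiP[jN Pj].
by apply/mapP; exists (Ordinal jN) => //; rewrite mem_enum inE.
Qed.

Section BaseFamily.
(* Vertices [0, x) and the vertex [x] at infinity, with [p] vertices of A and [q + 1] of
   B. Colour [i < x] joins [u] and [v] when [u + v = i] modulo [x], except for the
   removed edges: a path and a perfect matching on [0, p). Vertex [k] is joined to
   infinity by the colour [2k] of its own loop, by the colour [2k + 1] of the removed
   path edge [{k, k + 1}], and by the extra colour [x + k - 1]; so [k < p] is joined to
   infinity as many times as it has lost edges. [p = 0] serves the case [a = 2]. *)
Variables x q p : nat.
Hypotheses (odd_x : odd x) (odd_q : odd q) (even_p : ~~ odd p).
Hypotheses (p04 : (p == 0) || (4 <= p)) (px : p.*2 <= x.+1) (pq : p <= q.+1).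

Definition removed u v :=
  [&& u < p, v < p & [|| u == v.+1, v == u.+1, u == v + p./2 | v == u + p./2]].

(** The neighbour of infinity in colour [i]; the value [x], infinity itself, stands for none. *)
Definition inf_nbr i :=
  if i < p.*2.-1 then i./2 else
  if (x <= i) && (i < x + p.-1) then (i - x).+1 else x.

Definition sum_nbr i v := if v <= i then i - v else i + x - v.

Definition base i v :=
  if v == x then inf_nbr i else
  if inf_nbr i == v then x else
  if (i < x) && ~~ removed v (sum_nbr i v) then sum_nbr i v else v.

Variant inf_nbr_spec i : nat -> Prop :=
  | InfSum of i < p.*2.-1 : inf_nbr_spec i i./2
  | InfExtra of x <= i & i < x + p.-1 : inf_nbr_spec i (i - x).+1
  | InfNone of p.*2.-1 <= i & (i < x) || (x + p.-1 <= i) : inf_nbr_spec i x.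

Lemma inf_nbrP i : inf_nbr_spec i (inf_nbr i).
Proof.
rewrite /inf_nbr; case: ifP => c1; first by constructor.
by case: ifP => c2; constructor; lia.
Qed.

Lemma inf_nbr_le i : inf_nbr i <= x.
Proof. by case: inf_nbrP; move=> *; lia. Qed.

Lemma sum_nbr_lt i v : i < x -> v < x -> sum_nbr i v < x.
Proof. by rewrite /sum_nbr; case: ifP; move=> *; lia. Qed.

Lemma sum_nbrK i v : i < x -> v < x -> sum_nbr i (sum_nbr i v) = v.
Proof. by rewrite /sum_nbr; case: (leqP v i) => ? ? ?; case: ifP; move=> *; lia. Qed.

Lemma removedC u v : removed u v = removed v u.
Proof. by rewrite /removed; lia. Qed.

(** A vertex joined to infinity in colour [i] was free in that colour: it carried a loop or a
    removed edge. Hence no other edge is broken and [base i] is an involution. *)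
Lemma inf_nbr_sum i v : i < x -> v < x -> inf_nbr i = sum_nbr i v ->
  (sum_nbr i v == v) || removed v (sum_nbr i v).
Proof. by rewrite /removed /sum_nbr; case: inf_nbrP; case: ifP; move=> *; lia. Qed.

Lemma base_le i v : v <= x -> base i v <= x.
Proof.
rewrite /base => vx; case: eqP => [_|/eqP vNx]; first exact: inf_nbr_le.
case: eqP => // _; case: ifP => // /andP[ix _]; apply/ltnW/sum_nbr_lt => //; lia.
Qed.

Lemma baseK i v : v <= x -> base i (base i v) = v.
Proof.
move=> vx; rewrite {2}/base; case: (v =P x) => [->|/eqP vNx].
  rewrite /base; case: (inf_nbr i =P x) => [//|/eqP iNx].
  by rewrite eqxx.
have {vx vNx} vx : v < x by lia.
case: (inf_nbr i =P v) => [iv|iv]; first by rewrite /base eqxx.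
case: ifP => [/andP[ix rem]|rem]; last first.
  by rewrite /base (ltn_eqF vx) rem; case: eqP iv.
have rx := sum_nbr_lt ix vx.
rewrite /base (ltn_eqF rx); case: eqP => [ir|ir].
  have := inf_nbr_sum ix vx ir; rewrite (negbTE rem) orbF => /eqP rv.
  by rewrite rv in ir.
by rewrite ix sum_nbrK // removedC rem.
Qed.

Definition sum_col u v := if u + v < x then u + v else u + v - x.

Lemma sum_colP u v : u < x -> v < x ->
  sum_col u v < x /\ sum_nbr (sum_col u v) u = v.
Proof. by rewrite /sum_col /sum_nbr; do 2 case: ifP; move=> *; lia. Qed.

Lemma base_edge u v : u < x -> v < x -> u != v -> ~~ removed u v ->
  base (sum_col u v) u = v.
Proof.
move=> ux vx uv rem; have [cx cE] := sum_colP ux vx; have [_ cE'] := sum_colP vx ux.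
rewrite /base (ltn_eqF ux) cx cE rem; case: eqP => // iu.
have sC : sum_col v u = sum_col u v by rewrite /sum_col addnC.
have := @inf_nbr_sum (sum_col u v) v cx vx; rewrite -{2 3 4}sC cE' removedC.
by rewrite (negbTE rem) (negbTE uv) => /(_ iu).
Qed.

(** Lists the [q.+1] colours missed at [v]. Index 0 is the removed matching edge, or the loop when
    [p <= v]. The other indices give the extra colours, except that for [0 < v < p] the colour
    [x + v.-1], spent on infinity, is replaced by that of the removed edge [{v - 1, v}]. *)
Definition miss_col v j :=
  if j == 0 then
    if v < p then v + (if v < p./2 then v + p./2 else v - p./2) else sum_col v v
  else if (v < p) && (j == v) then v.*2.-1 else x + j.-1.

Lemma base_fixE i v : v < x -> (base i v == v) =
  (inf_nbr i != v) && [|| x <= i, sum_nbr i v == v | removed v (sum_nbr i v)].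
Proof.
move=> vx; rewrite /base (ltn_eqF vx); case: (inf_nbr i =P v) => _; first by rewrite gtn_eqF.
rewrite [x <= i]leqNgt; case: (i < x) => /=; last by rewrite eqxx.
by case: (removed _ _); rewrite ?eqxx ?orbT ?orbF.
Qed.

Lemma inf_nbr_neq i v : v < x -> (inf_nbr i != v) =
  [&& i != v.*2, (p <= v.+1) || (i != v.*2.+1) & [|| v == 0, p <= v | i.+1 != x + v]] || (p <= v).
Proof. by move=> vx; case: inf_nbrP => *; lia. Qed.

Lemma miss_colP v j : v < x -> j < q.+1 ->
  miss_col v j < x + q /\ base (miss_col v j) v == v.
Proof.
move=> vx jq; rewrite base_fixE // inf_nbr_neq // /removed /sum_nbr /miss_col /sum_col.
have [_|j0] := eqVneq j 0; last first.
  by case: ifP => vj; case: ifP => *; lia.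
case: (ltnP v p) => vp; last by case: ifP => *; case: ifP => *; lia.
by case: ifP => *; case: ifP => *; lia.
Qed.

Lemma miss_col_surj v i : v < x -> i < x + q -> base i v == v ->
  exists2 j, j < q.+1 & i = miss_col v j.
Proof.
move=> vx iq; rewrite base_fixE // inf_nbr_neq // => /andP[iv].
case: (ltnP i x) => /= ix; last first.
  move=> _; have jq : (i - x).+1 < q.+1 by lia.
  by exists (i - x).+1 => //; rewrite /miss_col /=; case: ifP => *; lia.
case/orP => [|rem].
  rewrite /sum_nbr /miss_col /sum_col => e; exists 0 => //=.
  by move: e; case: (leqP v i) => ? ?; do ?[case: ifP => ?]; lia.
have vp : v < p by move: rem; rewrite /removed => *; lia.
have [e|e] := eqVneq i.+1 v.*2.
  by exists v; [lia|rewrite /miss_col vp eqxx; case: eqP => *; rewrite /=; lia].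
exists 0 => //; rewrite /miss_col vp /=.
by move: rem iv; rewrite /removed /sum_nbr; case: (leqP v i) => ? ? ?; case: ifP => ?; lia.
Qed.

Lemma miss_col_inj v j k : v < x -> j < q.+1 -> k < q.+1 ->
  miss_col v j = miss_col v k -> j = k.
Proof.
move=> vx jq kq; rewrite /miss_col /sum_col.
by case: eqP => j0; case: eqP => k0; do ?[case: ifP => ? /=]; lia.
Qed.

Lemma base_family : exists f : 'I_(x + q) -> 'I_x.+1 -> 'I_x.+1,
  [/\ forall k, involutive (f k),
      forall v : 'I_x.+1, v < x -> mult f v v = q.+1,
      mult f ord_max ord_max <= x + q - (3 * p - 2) &
      forall u v : 'I_x.+1, u < x -> v < x -> u != v -> ~~ removed u v ->
        0 < mult f u v].
Proof.
pose f (i : 'I_(x + q)) (v : 'I_x.+1) : 'I_x.+1 := inord (base i v).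
have valf i v : f i v = base i v :> nat.
  by rewrite inordK // ltnS base_le // -ltnS.
have multE u v : mult f u v = #|[set i : 'I_(x + q) | base i u == v]|.
  by apply: eq_card => i; rewrite !inE -val_eqE /= valf.
exists f; split.
- by move=> k v; apply: val_inj; rewrite /= !valf baseK // -ltnS.
- move=> v vx; rewrite multE; apply/eqP; rewrite eqn_leq; apply/andP; split.
    apply: (@card_ord_surj _ _ (fun i => base i v == v) (miss_col v)) => i iN.
    exact: miss_col_surj.
  apply: (@card_ord_inj _ _ (fun i => base i v == v) (miss_col v)).
    by move=> j; apply: miss_colP.
  by move=> j k; apply: miss_col_inj.
- rewrite multE /=.
  (* Infinity misses the colours from [2p - 1] to [x - 1] and those from [x + p - 1] on; the second
     shift skips the [p - 1] extra colours in between. *)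
  apply: (@card_ord_surj _ _ (fun i => base i x == x)
    (fun j => if j + p.*2.-1 < x then j + p.*2.-1 else j + (3 * p - 2))) => i iN.
  rewrite /base eqxx; case: inf_nbrP => [? ?|? ? ?|ip ipx _]; [lia|lia|].
  exists (if i < x then i - p.*2.-1 else i - (3 * p - 2)); case: (ltnP i x) => ?; try lia.
    by case: ifP => ?; lia.
  by case: ifP => ?; lia.
move=> u v ux vx uv rem; rewrite multE; apply/card_gt0P.
have [cx _] := sum_colP ux vx.
exists (widen_ord (leq_addr q x) (Ordinal cx)).
by rewrite inE /= base_edge.
Qed.

Hypothesis few_missing : x + q <= q.+1 * q + (3 * p - 2).

(** [few_missing] says that the missing incidences, those at infinity included, number at most
    [(x + q) * q.+1]. Infinity also makes the order [x.+1] even, like [q.+1], so [equalize]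
    applies. *)
Lemma balanced_family : exists f : 'I_(x + q) -> 'I_x.+1 -> 'I_x.+1,
  [/\ forall k, involutive (f k),
      forall v : 'I_x.+1, v < x -> mult f v v = q.+1,
      forall k, #|fixpts (f k)| <= q.+1 &
      forall u v : 'I_x.+1, u < x -> v < x -> u != v -> ~~ removed u v ->
        0 < mult f u v].
Proof.
have [f [fK fix_f fix_inf f_edge]] := base_family.
have [||f' [f'K mf' le_f']] := equalize (K := q.+1) fK.
- by rewrite card_ord /= odd_x odd_q.
- rewrite sum_fixpts card_ord big_ord_recr /=.
  rewrite (eq_bigr (fun=> q.+1)); last by move=> v _; apply: fix_f => /=.
  by rewrite sum_nat_const card_ord; lia.
exists f'; split=> // [v vx|u v ux vx uv rem]; first by rewrite mf' fix_f.
by rewrite mf' f_edge.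
Qed.

Definition near_edge u v :=
  [&& u < x + q.+1, v < x + q.+1, u != v, ~~ removed u v & (u < x) || (v < x)].

(** Edges below [x] keep the colours of the balanced family. The pairs of a vertex and a colour it
    misses form a bipartite graph of maximum degree [q.+1], whose [q.+1] matchings colour the edges
    at the vertices from [x] on. *)
Lemma near_complete_coloring : exists c : nat -> nat -> nat,
  [/\ forall u v, c u v = c v u, forall u v, near_edge u v -> c u v < x + q &
      forall u v w, near_edge u v -> near_edge u w -> v != w -> c u v != c u w].
Proof.
have [f [fK fix_f le_f f_edge]] := balanced_family.
pose E := [set z : 'I_x.+1 * 'I_(x + q) | (z.1 < x) && (f z.2 z.1 == z.1)].
have rowE (u : 'I_x.+1) : u < x -> #|[set i | (u, i) \in E]| = q.+1.
  by move=> ux; rewrite -(fix_f u ux); apply: eq_card => i; rewrite !inE ux.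
have [||g [gK g_row _ gE]] := @konig _ _ 'I_q.+1 E.
- move=> u; rewrite card_ord; case: (ltnP u x) => [/rowE -> //|xu].
  by rewrite eq_card0 // => i; rewrite !inE /= ltnNge xu.
- move=> i; rewrite card_ord; apply: leq_trans (le_f i).
  by apply/subset_leq_card/subsetP => u; rewrite !inE => /andP[].
pose rho u v := if [pick i | f i (inord u) == inord v] is Some i then val i else 0.
(* The edge from [u] to [x + k] gets the colour matched to [u] by the matching of index [k]. The
   default 0, here and in [rho], is never reached on an edge. *)
pose sigma u k := if g (inord k) (inl (inord u)) is inr i then val i else 0.
pose c u v := let lo := minn u v in let hi := maxn u v in
  if hi < x then rho lo hi else sigma lo (hi - x).
have inner u v : u < x -> v < x -> u != v -> ~~ removed u v ->
    exists2 i : 'I_(x + q), c u v = i & f i (inord u) = inord v.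
  move=> ux vx uv rem.
  wlog uv_lt : u v ux vx uv rem / u < v.
    move=> wl; have [lt|lt|e] := ltngtP u v; [exact: wl| |by rewrite e eqxx in uv].
    have [||i ci fi] := wl v u vx ux _ _ lt; rewrite 1?eq_sym 1?removedC //.
    by exists i; [rewrite /c minnC maxnC|rewrite -fi fK].
  rewrite /c; have -> : minn u v = u by lia.
  have -> : maxn u v = v by lia.
  rewrite vx /rho; case: pickP => [i /eqP fi|fN]; first by exists i.
  have : 0 < mult f (inord u) (inord v).
    apply: f_edge; rewrite -1?val_eqE /= ?inordK //; try lia.
  by move=> /card_gt0P[i]; rewrite inE fN.
have outer u v : u < x -> x <= v < x + q.+1 ->
    exists i : 'I_(x + q), [/\ c u v = i, c v u = i, g (inord (v - x)) (inl (inord u)) = inr i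
      & f i (inord u) = inord u].
  move=> ux /andP[xv vxq]; rewrite /c minnC maxnC.
  have -> : minn v u = u by lia.
  have -> : maxn v u = v by lia.
  rewrite ltnNge xv /= /sigma; set k := inord _; set w := inord u.
  have wx : w < x by rewrite inordK; lia.
  (* [w] misses exactly [q.+1] colours and there are [q.+1] matchings, so every matching covers
     [w]. *)
  have nofix : mult g (inl w) (inl w) = 0.
    have := sum_mult g (inl w); rewrite big_sumType (bigD1 w) //= big1 ?addn0; last first.
      by move=> w' w'w; rewrite g_row // eq_sym.
    rewrite (eq_bigr (fun i => ((w, i) \in E : nat))); last by move=> i _; rewrite gE.
    have -> : \sum_i ((w, i) \in E : nat) = q.+1.
      by rewrite -(rowE w wx) -sum1dep_card [RHS]big_mkcond; apply: eq_bigr => i _; case: ifP.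
    by rewrite card_ord; lia.
  case gkw : (g k (inl w)) => [w'|i].
    have : 0 < mult g (inl w) (inl w') by apply/card_gt0P; exists k; rewrite inE gkw.
    have [<-|ww'] := eqVneq w w'; first by rewrite nofix.
    by rewrite g_row.
  exists i; split=> //.
  have : 0 < mult g (inl w) (inr i) by apply/card_gt0P; exists k; rewrite inE gkw.
  by rewrite gE inE /= wx; case: eqP.
have cC u v : c u v = c v u by rewrite /c minnC maxnC.
exists c; split=> // [u v|u v w].
  case/and5P => un vn uv rem; case: (ltnP u x) => ux; case: (ltnP v x) => vx // _.
  - by have [i -> _] := inner u v ux vx uv rem.
  - by have [|i [-> _ _ _]] := outer u v ux; rewrite ?vx ?vn.
  - by have [|i [_ -> _ _]] := outer v u vx; rewrite ?ux ?un.
case/and5P => un vn uv ruv uvx /and5P[_ wn uw ruw uwx] vw; apply/eqP => cvw.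
have inordI (a b : nat) n : a < n.+1 -> b < n.+1 -> inord a = inord b :> 'I_n.+1 -> a = b.
  by move=> an bn ab; rewrite -(inordK an) ab inordK.
case: (ltnP u x) uvx uwx => [ux _ _|ux /= vx wx]; last first.
  have [|i [_ ci gi _]] := outer v u vx; first by rewrite ux un.
  have [|j [_ cj gj _]] := outer w u wx; first by rewrite ux un.
  have ij : i = j by apply: val_inj; rewrite /= -ci cvw cj.
  (* One matching sends both [v] and [w] to the same colour, which forces them to be equal. *)
  have := etrans gi (esym (etrans gj (congr1 _ (esym ij)))).
  move=> /(inv_inj (gK _))[/inordI e]; move: vw; rewrite e ?eqxx //; lia.
wlog vw_le : v w vn wn uv uw ruv ruw vw cvw / v <= w.
  move=> wl; have [le|/ltnW le] := leqP v w; first exact: (wl v w).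
  by apply: (wl w v) => //; rewrite eq_sym.
case: (ltnP v x) => vx; case: (ltnP w x) => wx; try lia.
- have [i ci fi] := inner u v ux vx uv ruv; have [j cj fj] := inner u w ux wx uw ruw.
  have ij : i = j by apply: val_inj; rewrite /= -ci cvw cj.
  move: vw; rewrite (inordI v w x) ?eqxx //; try lia.
  by rewrite -fi -fj ij.
- have [i ci fi] := inner u v ux vx uv ruv.
  have [|j [cj _ _ fj]] := outer u w ux; first by rewrite wx.
  have ij : i = j by apply: val_inj; rewrite /= -ci cvw cj.
  move: uv; rewrite (inordI u v x) ?eqxx //; try lia.
  by rewrite -fi ij fj.
have [|i [ci _ gi _]] := outer u v ux; first by rewrite vx.
have [|j [cj _ gj _]] := outer u w ux; first by rewrite wx.
have ij : i = j by apply: val_inj; rewrite /= -ci cvw cj.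
rewrite -ij in gj.
(* The pair of [u] and [i] lies in at most one matching, so both edges end at the same vertex. *)
have : mult g (inl (inord u)) (inr i) <= 1 by rewrite gE; case: (_ \in _).
move=> /card_le1_eqP /(_ (inord (v - x)) (inord (w - x))).
rewrite !inE gi gj eqxx => /(_ isT isT) vwk.
have vwx : w - x = v - x by apply: (inordI _ _ q _ _ vwk); lia.
have vE : v = w by lia.
by rewrite vE eqxx in vw.
Qed.
End BaseFamily.

(** * Edge colourings of finite graphs and of the complete multipartite graph *)

Definition edge_colorable (V : finType) (e : rel V) (k : nat) :=
  exists c : V -> V -> nat,
    [/\ forall u v, e u v -> c u v = c v u, forall u v, e u v -> c u v < k &
        forall u v w, e u v -> e u w -> v != w -> c u v != c u w].

Lemma sub_edge_colorable (V : finType) (e e' : rel V) k l :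
  subrel e e' -> k <= l -> edge_colorable e' k -> edge_colorable e l.
Proof.
move=> ee' kl [c [cC ck cP]]; exists c; split=> [u v|u v|u v w] /ee'.
- exact: cC.
- by move=> /ck/leq_trans; apply.
by move=> uv /ee'; apply: cP.
Qed.

(** Number the vertices of [D] and colour an edge by the sum of its ends modulo the order. *)
Lemma edge_colorable_order (V : finType) (e : rel V) (D : {set V}) :
  (forall u v, e u v -> (u \in D) && (v \in D)) -> edge_colorable e #|D|.
Proof.
move=> eD; exists (fun u v => (index u (enum D) + index v (enum D)) %% #|D|).
split=> [u v _|u v /eD/andP[uD _]|u v w /eD/andP[uD vD] /eD/andP[_ wD]].
- by rewrite addnC.
- by rewrite ltn_mod; apply/card_gt0P; exists u.
rewrite eqn_modDl; apply: contraNN => /eqP.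
rewrite !modn_small ?cardE ?index_mem ?mem_enum // => ind; apply/eqP.
by rewrite -(@nth_index _ v v (enum D)) ?mem_enum // ind nth_index // mem_enum.
Qed.

(* In a graph of odd order every colour misses a vertex, while a vertex of degree [d] is
   missed by at most [k - d] of the [k] colours. *)
Lemma overfull (V : finType) (e : rel V) (D : {set V}) k :
  irreflexive e -> symmetric e -> (forall u v, e u v -> u \in D) -> odd #|D| ->
  edge_colorable e k -> k <= \sum_(u in D) (k - #|[set v | e u v]|).
Proof.
move=> e_irr e_sym eD oddD [c [cC ck cP]].
pose h (i : 'I_k) u := if [pick v | e u v && (c u v == i)] is Some v then v else u.
have hE (i : 'I_k) u v : e u v -> c u v = i -> h i u = v.
  move=> uv cuv; rewrite /h; case: pickP => [w /andP[uw /eqP cuw]|/(_ v)]; last first.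
    by rewrite uv cuv eqxx.
  apply/eqP; have [//|wv] := eqVneq w v.
  by have := cP _ _ _ uw uv wv; rewrite cuw cuv eqxx.
have hP (i : 'I_k) u : h i u = u \/ e u (h i u) /\ c u (h i u) = i.
  by rewrite /h; case: pickP => [v /andP[uv /eqP cuv]|_]; [right|left].
have hK i : involutive (h i).
  move=> u; have [hu|[uv cuv]] := hP i u; first by rewrite !hu.
  by apply: hE; [rewrite e_sym|rewrite cC // e_sym].
pose miss (i : 'I_k) := fixpts (h i) :&: D.
(* [h i] fixes every vertex outside [D], so its fixed points in [D] have the parity of [D], which is
   odd. *)
have miss_gt0 i : 0 < #|miss i|.
  have := odd_fixpts (hK i); rewrite -(cardsID D) -(cardsC D).
  have -> : fixpts (h i) :\: D = ~: D.
    apply/setP => u; rewrite !inE; case: (boolP (u \in D)) => //= uD.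
    by have [->|[/eD]] := hP i u; rewrite ?eqxx // (negbTE uD).
  rewrite ![odd (_ + _)]ssrnat.oddD oddD => /addIb mD.
  by rewrite lt0n; apply: contraPneq mD => ->.
(* Every neighbour of [u] is [h i u] for some colour [i] not missed at [u]. *)
have missE u : u \in D -> #|[set i | u \in miss i]| <= k - #|[set v | e u v]|.
  move=> uD; set M := [set i | _].
  have : #|[set v | e u v]| <= #|~: M|.
    apply: leq_trans (leq_imset_card (h^~ u) _); apply/subset_leq_card/subsetP => v.
    rewrite inE => uv; apply/imsetP; exists (Ordinal (ck _ _ uv)); last by rewrite (hE _ _ _ uv).
    rewrite !inE (hE _ _ _ uv) // uD andbT; apply: contraTneq uv => ->.
    by rewrite e_irr.
  by have := cardsC M; rewrite card_ord; lia.
apply: (@leq_trans (\sum_(u in D) #|[set i | u \in miss i]|)); last exact: leq_sum.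
under eq_bigr do rewrite -sum1dep_card big_mkcond.
rewrite exchange_big /= -[X in X <= _]card_ord -sum1_card.
apply: leq_sum => i _; apply: leq_trans (miss_gt0 i) _.
rewrite -big_mkcondr sum1dep_card; apply/subset_leq_card/subsetP => u.
by rewrite !inE => /andP[-> ->].
Qed.

Section CompleteMultipartite.
Variables (V : finType) (A B C : {set V}).
Hypotheses (dAB : [disjoint A & B]) (dAC : [disjoint A & C]) (dBC : [disjoint B & C]).

(** The parts are [A], [B] and the singletons of [C]. *)
Definition multipartite (u v : V) :=
  [&& u \in A :|: B :|: C, v \in A :|: B :|: C, u != v,
      ~~ ((u \in A) && (v \in A)) & ~~ ((u \in B) && (v \in B))].

Let D := A :|: B :|: C.

Lemma multipartite_sym : symmetric multipartite.
Proof. by move=> u v; rewrite /multipartite eq_sym; do !case: (_ \in _). Qed.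

Lemma multipartite_irr : irreflexive multipartite.
Proof. by move=> u; rewrite /multipartite eqxx !andbF. Qed.

Lemma multipartite_mem u v : multipartite u v -> (u \in D) && (v \in D).
Proof. by case/and3P => -> ->. Qed.

Lemma card_multipartite : #|D| = #|A| + #|B| + #|C|.
Proof.
move: dAB dAC dBC; rewrite /D !cardsU -!setI_eq0 => /eqP AB /eqP AC /eqP BC.
by rewrite setIUl AC BC setU0 AB !cards0 !subn0.
Qed.

Lemma degA u : u \in A -> #|[set v | multipartite u v]| = #|B| + #|C|.
Proof.
move=> uA; have uB : u \notin B by rewrite (disjointFr dAB).
have -> : [set v | multipartite u v] = D :\: A.
  apply/setP => v; rewrite !inE /multipartite !inE uA (negbTE uB) /= andbT.
  case: (boolP (v \in A)) => [|vA]; rewrite ?andbF ?andbT //=.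
  have -> : u != v by apply: contraNneq vA => <-.
  by rewrite ?andbT ?andbF.
rewrite cardsD card_multipartite (setIidPr _); first by lia.
by rewrite /D -setUA subsetUl.
Qed.

Lemma degB u : u \in B -> #|[set v | multipartite u v]| = #|A| + #|C|.
Proof.
move=> uB; have uA : u \notin A by rewrite (disjointFl dAB).
have -> : [set v | multipartite u v] = D :\: B.
  apply/setP => v; rewrite !inE /multipartite !inE uB (negbTE uA) /=.
  case: (boolP (v \in B)) => [|vB]; rewrite ?andbF ?andbT //=.
  have -> : u != v by apply: contraNneq vB => <-.
  by rewrite ?andbT ?andbF.
rewrite cardsD card_multipartite (setIidPr _); first by lia.
by rewrite /D setUAC subsetUr.
Qed.

Lemma degC u : u \in C -> #|[set v | multipartite u v]| = (#|A| + #|B| + #|C|).-1.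
Proof.
move=> uC; have uA : u \notin A by rewrite (disjointFl dAC).
have uB : u \notin B by rewrite (disjointFl dBC).
have uD : u \in D by rewrite !inE uC orbT.
rewrite -card_multipartite (cardsD1 u D) uD /=; apply: eq_card => v.
by rewrite !inE /multipartite !inE uC (negbTE uA) (negbTE uB) /= andbT andbC eq_sym.
Qed.

End CompleteMultipartite.

Lemma multipartite_class1 (V : finType) (A B C : {set V}) :
  [disjoint A & B] -> [disjoint A & C] -> [disjoint B & C] ->
  ~~ odd #|A| -> ~~ odd #|B| -> 2 <= #|A| -> 2 <= #|B| ->
  #|C| = (#|A| * #|B|).-1 -> (#|A| != 2) || (#|B| != 2) ->
  edge_colorable (multipartite A B C) (#|A| + #|B| + #|C|).-1.
Proof.
wlog leAB : A B / #|A| <= #|B|.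
  move=> wl dAB dAC dBC oA oB A2 B2 cC AB2; have [le|/ltnW le] := leqP #|A| #|B|; first exact: wl.
  rewrite [#|A| + _]addnC; apply: sub_edge_colorable (leqnn _) (wl B A le _ _ _ _ _ _ _ _ _) => //.
  - by move=> u v; rewrite /multipartite [A :|: B]setUC; case/and5P=> -> -> -> -> ->.
  - by rewrite disjoint_sym.
  - by rewrite mulnC.
  by rewrite orbC.
move=> dAB dAC dBC oddA oddB A2 B2 cC AB2.
(* Numbering [A] first and [B] last puts the removed edges inside [A] and makes [B] the interval
   starting at [x]. *)
pose s := enum A ++ enum C ++ enum B; pose iota v := index v s.
pose x := #|A| + #|C|; pose q := #|B|.-1; pose p := if #|A| == 2 then 0 else #|A|.
have xq : x + q = (#|A| + #|B| + #|C|).-1 by rewrite /x /q; lia.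
have oddAB : ~~ odd (#|A| * #|B|) by rewrite oddM (negbTE oddA).
have AB4 : 2 * #|B| <= #|A| * #|B| by rewrite leq_mul2r A2 orbT.
have [||||||| c [c_sym c_lt c_proper]] := @near_complete_coloring x q p.
- by rewrite /x; lia.
- by rewrite /q; lia.
- by rewrite /p; case: ifP.
- by rewrite /p; case: ifP => // /eqP ?; lia.
- by rewrite /p /x; case: ifP => // /eqP ?; lia.
- by rewrite /p /q; case: ifP => // /eqP ?; lia.
(* With a and b the sizes of [A] and [B], [few_missing] reads 3b <= b(b-1) for a = 2, whence b >= 4.
   Otherwise it amounts to a(b-2) <= b(b-2), an equality when a = b. *)
- rewrite /p /x /q; case: ifP => [/eqP A2'|/eqP A2'].
    by have ? : 4 <= #|B| by [lia]; nia.
  by nia.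
have iotaA u : u \in A -> iota u < #|A|.
  by move=> uA; rewrite /iota index_cat mem_enum uA cardE index_mem mem_enum.
have iotaC u : u \in C -> #|A| <= iota u < x.
  move=> uC; rewrite /iota !index_cat !mem_enum uC (disjointFl dAC uC) -cardE leq_addr /=.
  by rewrite ltn_add2l cardE index_mem mem_enum.
have iotaB u : u \in B -> x <= iota u < x + q.+1.
  move=> uB; rewrite /iota !index_cat !mem_enum (disjointFl dAB uB) (disjointFr dBC uB) -!cardE.
  rewrite addnA leq_addr /= ltn_add2l (_ : q.+1 = #|B|); last by rewrite /q; lia.
  by rewrite cardE index_mem mem_enum.
have iota_inj u v : u \in s -> v \in s -> iota u = iota v -> u = v.
  by move=> us vs uv; rewrite -(nth_index u us) -/(iota u) uv nth_index.
have in_s u : u \in A :|: B :|: C -> u \in s.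
  by rewrite !inE !mem_cat !mem_enum; do 3 case: (_ \in _).
have inA u : u \in A :|: B :|: C -> iota u < p -> u \in A.
  move=> uD; rewrite /p; case: ifP => // _ up; move: uD; rewrite !inE.
  by case/orP => [/orP[//|/iotaB]|/iotaC]; rewrite /x; lia.
have inB u : u \in A :|: B :|: C -> x <= iota u -> u \in B.
  by move=> + xu; rewrite !inE => /orP[/orP[/iotaA|//]|/iotaC]; rewrite /x in xu *; lia.
have iotaD u : u \in A :|: B :|: C -> iota u < x + q.+1.
  by rewrite !inE => /orP[/orP[/iotaA|/iotaB/andP[]//]|/iotaC]; rewrite /x /q; lia.
have mpE u v : multipartite A B C u v -> near_edge x q p (iota u) (iota v).
  case/and5P => uD vD uv uvA uvB; apply/and5P; split.
  - exact: iotaD.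
  - exact: iotaD.
  - by apply: contra_neq uv; apply: iota_inj; apply: in_s.
  - rewrite /removed; apply: contra uvA => /and3P[up vp _].
    by rewrite !inA.
  - apply: contraNT uvB; rewrite negb_or -!leqNgt => /andP[xu xv].
    by rewrite !inB.
exists (fun u v => c (iota u) (iota v)); split=> [u v _|u v /mpE|u v w uv uw vw].
- exact: c_sym.
- by rewrite -xq; apply: c_lt.
apply: c_proper; [exact: mpE|exact: mpE|].
apply: contra_neq vw; apply: iota_inj; apply: in_s.
  by case/and3P: uv.
by case/and3P: uw.
Qed.

Require Import Defs.
From HB Require Import structures.
From mathcomp Require Import all_boot all_order all_algebra.
From mathcomp Require Import boolp classical_sets functions cardinality.

Import GRing.Theory.

Local Open Scope classical_set_scope.
Local Open Scope card_scope.

(** * Transfer to finite graphs, and the class of the multipartite graph *)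

Section EdgeColoringTransfer.
Variables (T : Type) (G : simple_graph T) (V : finType) (phi : V -> T).
Variables (D : {set V}) (e : rel V).
Hypothesis phi_inj : injective phi.
Hypothesis verticesE : forall x, vertices G x <-> exists2 u, u \in D & x = phi u.
Hypothesis adjE : forall u v, adj G (phi u) (phi v) <-> e u v.
Hypotheses (e_sym : symmetric e) (e_irr : irreflexive e).

Lemma edgesP E : edges G E <-> exists u v, e u v /\ E = [set phi u; phi v].
Proof.
split=> [[x [y [xy ->]]]|[u [v [uv ->]]]]; last by exists (phi u), (phi v); rewrite adjE.
have [xG yG] := adj_vertices xy.
have [u _ xE] := (verticesE _).1 xG; have [v _ yE] := (verticesE _).1 yG.
by exists u, v; rewrite xE yE -adjE -xE -yE.
Qed.

Lemma set2_phi u v u' v' : [set phi u; phi v] = [set phi u'; phi v'] ->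
  (u = u' /\ v = v') \/ (u = v' /\ v = u').
Proof.
move=> E.
have: [set phi u'; phi v'] (phi u) by rewrite -E; left.
have: [set phi u'; phi v'] (phi v) by rewrite -E; right.
have: [set phi u; phi v] (phi u') by rewrite E; left.
have: [set phi u; phi v] (phi v') by rewrite E; right.
by case=> /phi_inj v'E [] /phi_inj u'E [] /phi_inj vE [] /phi_inj uE; subst; auto.
Qed.

Lemma edge_coloring_transfer k :
  (exists c, edge_coloring G k c) <-> edge_colorable e k.
Proof.
split=> [[c [ck cP]]|[c [cC ck cP]]].
  exists (fun u v => c [set phi u; phi v]); split=> [u v _|u v uv|u v w uv uw vw].
  - by congr c; apply/seteqP; split=> x /=; tauto.
  - by apply: ck; apply/edgesP; exists u, v.
  apply/eqP/cP; try by [apply/edgesP; exists u, v|apply/edgesP; exists u, w].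
    move=> /set2_phi[[_ vwE]|[uwE vuE]]; first by rewrite vwE eqxx in vw.
    by move: uw; rewrite uwE e_irr.
  by exists (phi u); split; left.
(* Either order of the ends may be picked; [c] gives both the same colour. Sets that are not edges
   get 0. *)
pose c' (E : set T) := if [pick z | e z.1 z.2 && `[< E = [set phi z.1; phi z.2] >] ] is Some z
  then c z.1 z.2 else 0%N.
have c'E u v : e u v -> c' [set phi u; phi v] = c u v.
  move=> uv; rewrite /c'; case: pickP => [[u' v'] /= /andP[uv' /asboolP]|/(_ (u, v))]; last first.
    by rewrite /= uv asboolT.
  by move=> /set2_phi[[-> ->]//|[-> ->]]; apply: cC.
exists c'; split=> [E /edgesP[u [v [uv ->]]]|E F /edgesP[u [v [uv ->]]] /edgesP[u' [v' [uv' ->]]]].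
  by rewrite c'E ?ck.
move=> EF [x [xE xF]].
(* Each of the two edges is rewritten with the common end [x] first. *)
have ends a b : e a b -> [set phi a; phi b] x -> exists w s, [/\ x = phi w, e w s &
    [set phi a; phi b] = [set phi w; phi s] /\ c' [set phi a; phi b] = c w s].
  move=> ab []->; first by exists a, b; split=> //; rewrite c'E.
  exists b, a; rewrite e_sym c'E // cC //; split=> //; split=> //.
  by apply/seteqP; split=> y /=; tauto.
have [w [s [xw ws [EE ->]]]] := ends _ _ uv xE.
have [w' [s' [xw' ws' [FE ->]]]] := ends _ _ uv' xF.
have ww' : w' = w by apply: phi_inj; rewrite -xw -xw'.
rewrite {}ww' in ws' FE * => cE; apply: EF; rewrite EE FE.
have [->//|ss'] := eqVneq s s'.
by have := cP _ _ _ ws ws' ss'; rewrite cE eqxx.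
Qed.

Lemma has_degree_transfer u d : has_degree G (phi u) d <-> #|[set v | e u v]%SET| = d.
Proof.
set X := [set v | e u v]%SET; pose f i := phi (nth u (enum X) i).
have fX : f @` `I_#|X| = [set y | adj G (phi u) y].
  apply/seteqP; split=> [_ [i /= iX <-]|y /= uy].
    have : nth u (enum X) i \in X by rewrite -mem_enum mem_nth // -cardE.
    by rewrite inE => /adjE.
  have [_ yG] := adj_vertices uy; have [v _ yE] := (verticesE _).1 yG; rewrite yE in uy *.
  move/adjE in uy; exists (index v (enum X)).
    by rewrite /= cardE index_mem mem_enum inE.
  by rewrite /f nth_index // mem_enum inE.
have cardX : [set y | adj G (phi u) y] #= `I_#|X|.
  rewrite -fX; apply: inj_card_eq => i j; rewrite !inE /= => iX jX /phi_inj/eqP.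
  by rewrite nth_uniq -?cardE ?enum_uniq // => /eqP.
split=> [dG|<- //]; apply/card_eq_II.
by apply: card_eq_trans dG; apply: card_esym.
Qed.

End EdgeColoringTransfer.

Lemma class2_multipartite (T : Type) (G : simple_graph T) (V : finType)
    (phi : V -> T) (A B C : {set V}) :
  injective phi ->
  (forall x, vertices G x <-> exists2 u, u \in (A :|: B :|: C)%SET & x = phi u) ->
  (forall u v, adj G (phi u) (phi v) <-> multipartite A B C u v) ->
  [disjoint A & B]%B -> [disjoint A & C]%B -> [disjoint B & C]%B ->
  ~~ odd #|A| -> ~~ odd #|B| -> (2 <= #|A|)%N -> (2 <= #|B|)%N ->
  #|C| = (#|A| * #|B|).-1 ->
  class2 G <-> #|A| = 2%N /\ #|B| = 2%N.
Proof.
move=> phi_inj vE adjE dAB dAC dBC oddA oddB A2 B2 cC.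
have mp_sym := multipartite_sym A B C; have mp_irr := multipartite_irr A B C.
have colP := edge_coloring_transfer phi_inj vE adjE mp_sym mp_irr.
have degP := has_degree_transfer phi_inj vE adjE.
set n := (#|A| + #|B| + #|C|)%N in colP *.
have AB4 : (4 <= #|A| * #|B|)%N by rewrite (leq_mul A2 B2).
have [w wC] : exists w, w \in C by apply/card_gt0P; rewrite cC; lia.
(* The vertices of [C] are adjacent to all others, and [C] is not empty. *)
have maxdeg d : is_max_degree G d <-> d = n.-1.
  have degw : has_degree G (phi w) n.-1 by apply/degP; rewrite degC.
  have wG : vertices G (phi w) by apply/vE; exists w => //; rewrite !inE wC orbT.
  have le_deg x : vertices G x -> exists2 m, has_degree G x m & (m <= n.-1)%N.
    move=> /vE[u uD ->]; exists #|[set v | multipartite A B C u v]%SET|; first exact/degP.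
    move: uD; rewrite !inE => /orP[/orP[]|] uX.
    - by rewrite degA // /n; lia.
    - by rewrite degB // /n; lia.
    - by rewrite degC.
  split=> [[[x xG degx] le_d]|->]; last by split=> //; exists (phi w).
  have [m degx' mn] := le_deg x xG; have [m' degw' md] := le_d _ wG.
  have [u _ xu] := (vE x).1 xG; rewrite xu in degx degx'.
  move/degP in degx; move/degP in degx'; move/degP in degw; move/degP in degw'.
  by apply/eqP; rewrite eqn_leq -degx degx' mn -degx' degx -degw degw' md.
split=> [[d [/maxdeg -> [_ min_n]]]|[A2' B2']].
  apply: contrapT => neq; have := multipartite_class1 dAB dAC dBC oddA oddB A2 B2 cC.
  case: (eqVneq #|A| 2%N) neq => [A2'|_]; last move=> _ /(_ isT)/colP/min_n; last by rewrite ltnn.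
  case: (eqVneq #|B| 2%N) => [B2' []//|_ _ /(_ isT)/colP/min_n]; by rewrite ltnn.
exists n.-1; split; first exact/maxdeg.
have nE : n = 7 by rewrite /n cC A2' B2'.
have cD := card_multipartite dAB dAC dBC.
have memD := @multipartite_mem _ A B C.
split.
  by apply/colP; have := edge_colorable_order memD; rewrite cD -/n nE.
move=> m /colP colm; rewrite leqNgt; apply/negP => mn.
have col6 : edge_colorable (multipartite A B C) 6.
  by apply: sub_edge_colorable colm => //; lia.
(* With six colours, the four vertices of [A] and [B], of degree 5, miss one colour each and those
   of [C], of degree 6, none: the bound would read 6 <= 4. *)
have := overfull mp_irr mp_sym (fun u v uv => proj1 (andP (memD u v uv))) _ col6.
rewrite cD -/n nE => /(_ isT).
rewrite (eq_bigl [in [predU [predU A & B] & C]]); last by move=> u; rewrite !inE.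
rewrite bigU; last first.
  by rewrite disjointU dAC dBC.
rewrite bigU //=.
rewrite (eq_bigr (fun=> 1%N)); last by move=> u uA; rewrite degA // cC A2' B2'.
rewrite [X in (_ + X + _)%N](eq_bigr (fun=> 1%N)); last by move=> u uB; rewrite degB // cC A2' B2'.
rewrite [X in (_ + _ + X)%N](eq_bigr (fun=> 0%N)); last by move=> u uC; rewrite degC // cC A2' B2'.
by rewrite !sum_nat_const A2' B2' muln0.
Qed.

(** * Ideals *)

Section IdealBasics.
Local Open Scope ring_scope.
Variable R : comNzRingType.
Implicit Types I J K : set R.

Lemma is_ideal_setT : is_ideal [set: R].
Proof. by []. Qed.

Lemma is_ideal_set0 : is_ideal [set (0 : R)].
Proof. by split=> [//|x y -> ->|a x ->]; rewrite /= ?addr0 ?mulr0. Qed.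

Lemma ideal1T I : is_ideal I -> I 1 -> I = setT.
Proof. by move=> [_ _ IM] I1; apply/seteqP; split=> // a _; rewrite -[a]mulr1; apply: IM. Qed.

Lemma ideal_neq0 I : is_ideal I -> I <> [set 0] -> exists2 x, I x & x <> 0.
Proof.
move=> [I0 _ _] In0; apply: contrapT => nex; apply: In0; apply/seteqP; split=> [x Ix|_ ->//].
by apply: contrapT => x0; apply: nex; exists x.
Qed.

Lemma neq_set0 I x : I x -> x <> 0 -> I <> [set 0].
Proof. by move=> Ix x0 I0; apply: x0; rewrite I0 in Ix. Qed.

Lemma setT_neq0 : [set: R] <> [set 0].
Proof. by apply: (@neq_set0 _ 1) => //; apply/eqP/oner_neq0. Qed.

Definition principal (x : R) : set R := [set y | exists a, y = a * x].

Lemma is_ideal_principal x : is_ideal (principal x).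
Proof.
split=> [|y z [a ->] [b ->]|a y [b ->]]; first by exists 0; rewrite mul0r.
  by exists (a + b); rewrite mulrDl.
by exists (a * b); rewrite mulrA.
Qed.

Lemma principal_sub I x : is_ideal I -> I x -> principal x `<=` I.
Proof. by move=> [_ _ IM] Ix _ [a ->]; apply: IM. Qed.

Lemma principal_id x : principal x x.
Proof. by exists 1; rewrite mul1r. Qed.

Lemma is_ideal_Ann I : is_ideal (Ann I).
Proof.
split=> [x _|r s Ir Is x Ix|a r Ir x Ix]; first by rewrite mul0r.
  by rewrite mulrDl Ir // Is // addr0.
by rewrite -mulrA Ir // mulr0.
Qed.

Lemma Ann_ideal_mul I J r :
  Ann (ideal_mul I J) r <-> forall x y, I x -> J y -> r * (x * y) = 0.
Proof.
split=> [annr x y Ix Jy|ann z [n [a [b [Ia Jb ->]]]]]; last first.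
  by rewrite mulr_sumr big1 // => i _; apply: ann.
by apply: annr; exists 1%N, (fun=> x), (fun=> y); split=> //; rewrite big_ord1.
Qed.

Lemma essential_sub I J : is_ideal J -> I `<=` J -> essential I -> essential J.
Proof.
move=> idJ IJ [idI In0 essI]; split=> // [J0|K idK Kn0].
  have [x Ix x0] := ideal_neq0 idI In0.
  by apply: x0; have := IJ x Ix; rewrite J0.
have idIK : is_ideal (I `&` K).
  case: idI idK => [I0 ID IM] [K0 KD KM]; split=> // [x y [? ?] [? ?]|a x [? ?]].
    by split; [apply: ID|apply: KD].
  by split; [apply: IM|apply: KM].
have [x [Ix Kx] x0] := ideal_neq0 idIK (essI K idK Kn0).
by apply: (@neq_set0 _ x) => //; split=> //; apply: IJ.
Qed.

End IdealBasics.

(** * Annihilators in a local ring with finitely many ideals *)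

Section FiniteLocalRing.
Local Open Scope ring_scope.
Variables (R : comNzRingType) (W : finType) (j : W -> set R).
Hypothesis idealE : forall I, is_ideal I <-> exists w, I = j w.
Hypothesis localR : local_ring R.
Implicit Types I J K : set R.

Let below I := [set w | `[< j w `<=` I >]]%SET.

(** The number of ideals contained in an ideal is strictly monotone; extremal ideals are chosen by
    this count. *)
Lemma card_below_eq I J : is_ideal J -> I `<=` J -> (#|below J| <= #|below I|)%N -> I = J.
Proof.
move=> /idealE[w Jw] IJ le; apply/seteqP; split=> //.
have bIJ : below I \subset below J.
  apply/fintype.subsetP => v; rewrite !finset.in_set => /asboolP wI.
  by apply/asboolP; exact: (classical_sets.subset_trans _ IJ).
have : w \in below J by rewrite finset.in_set; apply/asboolP; rewrite Jw.
have /eqP <- : below I == below J by rewrite eqEcard bIJ.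
by rewrite finset.in_set Jw => /asboolP.
Qed.

Lemma proper_sub_maximal I : is_proper_ideal I ->
  exists2 M, is_maximal_ideal M & I `<=` M.
Proof.
move=> [idI IT]; have /idealE[w0 Iw0] := idI.
pose P w := `[< is_proper_ideal (j w) /\ I `<=` j w >].
have P0 : P w0 by apply/asboolP; rewrite -Iw0; split.
have [w /asboolP[propw Iw] maxw] := arg_maxnP (fun w => #|below (j w)|) P0.
exists (j w) => //; split=> // J [idJ JT] wJ; apply: esym; apply: card_below_eq => //.
have /idealE[v Jv] := idJ; rewrite Jv; apply: maxw; apply/asboolP.
by rewrite -Jv; split=> //; exact: (classical_sets.subset_trans _ wJ).
Qed.

(** All proper ideals lie in the unique maximal ideal. If [1 - r] were not invertible, that ideal
    would contain both [r] and [1 - r], hence 1. *)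
Lemma one_sub_unit K r : is_proper_ideal K -> K r -> exists s, s * (1 - r) = 1.
Proof.
move=> propK Kr; have [M [maxM uniqM]] := localR.
have subM I : is_proper_ideal I -> I `<=` M.
  by move=> /proper_sub_maximal[N maxN IN]; rewrite (uniqM N).
apply: contrapT => nunit; have [[idM MT] _] := maxM.
apply: MT; apply: ideal1T => //.
have [_ MD _] := idM; rewrite -[1](subrK r); apply: MD; last exact: subM propK _ Kr.
apply: (subM (principal (1 - r))); last exact: principal_id.
split; first exact: is_ideal_principal.
move=> pT; apply: nunit; have : principal (1 - r) 1 by rewrite pT.
by case=> s e; exists s.
Qed.

(* A nonzero [x] in [J] generating a minimal principal ideal is killed by [K]: otherwise
   [x = s r x] for some [r] in [K], while [1 - s r] is invertible. *)
Lemma essential_Ann K : is_proper_ideal K -> essential (Ann K).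
Proof.
move=> propK; have [idK _] := propK.
have meet J : is_ideal J -> J <> [set 0] -> exists x, [/\ Ann K x, J x & x <> 0].
  move=> idJ /(ideal_neq0 idJ)[x0 Jx0 x0n0].
  pose P n := `[< exists x, [/\ J x, x <> 0 & #|below (principal x)| = n] >].
  have exP : exists n, P n by exists #|below (principal x0)|; apply/asboolP; exists x0.
  have [n /asboolP[x [Jx xn0 nE]] minn] := ex_minnP exP.
  exists x; split=> // r Kr; apply: contrapT; rewrite mulrC => rx0.
  have Jrx : J (r * x) by case: idJ => _ _; apply.
  have prx : principal (r * x) = principal x.
    apply: card_below_eq; first exact: is_ideal_principal.
      by apply: principal_sub; [apply: is_ideal_principal|exists r].
    by rewrite nE; apply: minn; apply/asboolP; exists (r * x).
  have [s xE] : principal (r * x) x by rewrite prx; apply: principal_id.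
  have Ksr : K (s * r) by case: idK => _ _; apply.
  have [u uE] := one_sub_unit propK Ksr.
  by apply: xn0; rewrite -[x]mul1r -uE -mulrA mulrBl mul1r -mulrA -xE subrr mulr0.
split; first exact: is_ideal_Ann.
  by have [x [annx _ x0]] := meet _ (is_ideal_setT R) (@setT_neq0 R); apply: neq_set0 x0.
by move=> J idJ J0; have [x [annx Jx x0]] := meet J idJ J0; apply: (neq_set0 (x := x)).
Qed.

(** If one factor is proper, its essential annihilator is contained in that of the product; if both
    are the whole ring, the annihilator is zero. *)
Lemma essential_Ann_mul I J : is_ideal I -> is_ideal J ->
  essential (Ann (ideal_mul I J)) <-> ~ (I = setT /\ J = setT).
Proof.
move=> idI idJ; split=> [[_ + _] [IT JT]|nT].
  apply; apply/seteqP; split=> [r /Ann_ideal_mul annr|_ ->]; last first.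
    by apply/Ann_ideal_mul => x y _ _; rewrite mul0r.
  by have := annr 1 1; rewrite IT JT !mulr1; apply.
have [IT|IT] := pselect (I = setT); last first.
  apply: essential_sub (essential_Ann (conj idI IT)); first exact: is_ideal_Ann.
  by move=> r annr; apply/Ann_ideal_mul => x y Ix _; rewrite mulrA annr // mul0r.
have JT : J <> setT by move=> JT; apply: nT.
apply: essential_sub (essential_Ann (conj idJ JT)); first exact: is_ideal_Ann.
by move=> r annr; apply/Ann_ideal_mul => x y _ Jy; rewrite mulrCA annr // mulr0.
Qed.

Lemma Ann_eq0 I : is_ideal I -> Ann I = [set 0] <-> I = setT.
Proof.
move=> idI; split=> [annI|->].
  apply: contrapT => IT; have [_ + _] := essential_Ann (conj idI IT); exact.
apply/seteqP; split=> [r annr|_ -> x _]; last by rewrite mul0r.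
by rewrite /= -[r]mulr1 annr.
Qed.

End FiniteLocalRing.

(** * Ideals of a product of two rings *)

Section ProductIdeals.
Local Open Scope ring_scope.
Variables R1 R2 : comNzRingType.
Implicit Types (I : set R1) (J : set R2) (K : set (R1 * R2)%type).

Definition prod_ideal I J : set (R1 * R2)%type := [set z | I z.1 /\ J z.2].

Lemma is_ideal_prod I J : is_ideal I -> is_ideal J -> is_ideal (prod_ideal I J).
Proof.
move=> [I0 ID IM] [J0 JD JM]; split=> [//|x y [? ?] [? ?]|a x [? ?]].
  by split; [apply: ID|apply: JD].
by split; [apply: IM|apply: JM].
Qed.

(** Multiplying by the idempotents [(1, 0)] and [(0, 1)] separates the two components. *)
Lemma ideal_prodP K : is_ideal K ->
  exists I J, [/\ is_ideal I, is_ideal J & K = prod_ideal I J].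
Proof.
move=> [K0 KD KM]; exists [set x | K (x, 0)], [set y | K (0, y)]; split.
- split=> [//|x y Kx Ky|a x Kx] /=.
    by rewrite -[0](addr0 0); apply: KD Kx Ky.
  by rewrite -[0](mulr0 0); apply: (KM (a, 0)) Kx.
- split=> [//|x y Kx Ky|a x Kx] /=.
    by rewrite -[0](addr0 0); apply: KD Kx Ky.
  by rewrite -[0](mulr0 0); apply: (KM (0, a)) Kx.
apply/seteqP; split=> [[x y] Kxy|[x y] [/= Kx Ky]].
  split=> /=.
    by rewrite -[x]mul1r -(mul0r y); apply: (KM (1, 0)) Kxy.
  by rewrite -[y]mul1r -(mul0r x); apply: (KM (0, 1)) Kxy.
by rewrite -[x]addr0 -[y]add0r; apply: KD Kx Ky.
Qed.

Lemma prod_ideal_inj I J I' J' :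
  is_ideal I -> is_ideal J -> is_ideal I' -> is_ideal J' ->
  prod_ideal I J = prod_ideal I' J' -> I = I' /\ J = J'.
Proof.
move=> [I0 _ _] [J0 _ _] [I'0 _ _] [J'0 _ _] E.
have EP x y : prod_ideal I J (x, y) <-> prod_ideal I' J' (x, y).
  by rewrite E.
split; apply/seteqP; split=> x xI.
- by have [] := (EP x 0).1 (conj xI J0).
- by have [] := (EP x 0).2 (conj xI J'0).
- by have [] := (EP 0 x).1 (conj I0 xI).
- by have [] := (EP 0 x).2 (conj I'0 xI).
Qed.

Lemma Ann_prod I J : is_ideal I -> is_ideal J ->
  Ann (prod_ideal I J) = prod_ideal (Ann I) (Ann J).
Proof.
move=> [I0 _ _] [J0 _ _]; apply/seteqP; split=> [[r s] ann|[r s] [/= annr anns] [x y] [/= Ix Jy]].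
  split=> /= x xI.
    by have /(congr1 fst) := ann (x, 0) (conj xI J0).
  by have /(congr1 snd) := ann (0, x) (conj I0 xI).
exact: (f_equal2 pair (annr _ Ix) (anns _ Jy)).
Qed.

Lemma Ann_mul_prod I J I' J' : is_ideal I -> is_ideal J -> is_ideal I' -> is_ideal J' ->
  Ann (ideal_mul (prod_ideal I J) (prod_ideal I' J')) =
  prod_ideal (Ann (ideal_mul I I')) (Ann (ideal_mul J J')).
Proof.
move=> [I0 _ _] [J0 _ _] [I'0 _ _] [J'0 _ _].
apply/seteqP; split=> [[r s] /Ann_ideal_mul ann|[r s] [/= /Ann_ideal_mul annr /Ann_ideal_mul anns]].
  split=> /=; apply/Ann_ideal_mul => x y xI yI.
    by have /(congr1 fst) := ann (x, 0) (y, 0) (conj xI J0) (conj yI J'0).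
  by have /(congr1 snd) := ann (0, x) (0, y) (conj I0 xI) (conj I'0 yI).
apply/Ann_ideal_mul => -[x y] [x' y'] [/= Ix Jy] [/= Ix' Jy'].
exact: (f_equal2 pair (annr _ _ Ix Ix') (anns _ _ Jy Jy')).
Qed.

(** A nonzero ideal of the product has a nonzero component, which meets [I] or [J]. Conversely,
    testing against [I'] times zero and zero times [J'] recovers each factor. *)
Lemma essential_prod I J : is_ideal I -> is_ideal J ->
  essential (prod_ideal I J) <-> essential I /\ essential J.
Proof.
move=> idI idJ; have idIJ := is_ideal_prod idI idJ; split; last first.
  move=> [[_ In0 essI] [_ Jn0 essJ]]; split=> //.
    have [x Ix x0] := ideal_neq0 idI In0.
    apply: (@neq_set0 _ _ (x, 0)); first by split=> //=; case: idJ.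
    by move=> [].
  move=> K /ideal_prodP[I' [J' [idI' idJ' ->]]] Kn0.
  have [I'0|I'n0] := pselect (I' = [set 0]); last first.
    have [x] : exists2 x, (I `&` I') x & x <> 0.
      apply: contrapT => nex; apply: (essI I' idI' I'n0); apply/seteqP.
      split=> [x xI|_ ->]; last by split; [case: idI|case: idI'].
      by apply: contrapT => x0; apply: nex; exists x.
    move=> [Ix I'x] x0; apply: (@neq_set0 _ _ (x, 0)); last by case.
    by split; split=> //=; [case: idJ|case: idJ'].
  have J'n0 : J' <> [set 0].
    move=> J'0; apply: Kn0; rewrite I'0 J'0; apply/seteqP.
    by split=> [[x y] [/= -> ->]|_ ->].
  have [x] : exists2 x, (J `&` J') x & x <> 0.
    apply: contrapT => nex; apply: (essJ J' idJ' J'n0); apply/seteqP.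
    split=> [x xI|_ ->]; last by split; [case: idJ|case: idJ'].
    by apply: contrapT => x0; apply: nex; exists x.
  move=> [Jx J'x] x0; apply: (@neq_set0 _ _ (0, x)); last by case.
  by split; split=> //=; [case: idI|case: idI'].
move=> [_ _ ess].
have meetI I' : is_ideal I' -> I' <> [set 0] -> I `&` I' <> [set 0].
  move=> idI' /(ideal_neq0 idI')[x I'x x0] II'0.
  apply: (ess (prod_ideal I' [set 0])).
  - exact: is_ideal_prod (is_ideal_set0 R2).
  - by apply: (@neq_set0 _ _ (x, 0)); [split|case].
  apply/seteqP; split=> [[u v] [[/= Iu Jv] [/= I'u ->]]|_ ->].
    have : (I `&` I') u by []. 
    by rewrite II'0 => ->.
  by split; split=> //=; [case: idI|case: idJ|case: idI'].
have meetJ J' : is_ideal J' -> J' <> [set 0] -> J `&` J' <> [set 0].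
  move=> idJ' /(ideal_neq0 idJ')[x J'x x0] JJ'0.
  apply: (ess (prod_ideal [set 0] J')).
  - exact: is_ideal_prod (is_ideal_set0 R1) _.
  - by apply: (@neq_set0 _ _ (0, x)); [split|case].
  apply/seteqP; split=> [[u v] [[/= Iu Jv] [/= -> J'v]]|_ ->].
    have : (J `&` J') v by []. 
    by rewrite JJ'0 => ->.
  by split; split=> //=; [case: idI|case: idJ|case: idJ'].
split; split=> //.
  by have := meetI _ (is_ideal_setT R1) (@setT_neq0 R1); rewrite setIT.
by have := meetJ _ (is_ideal_setT R2) (@setT_neq0 R2); rewrite setIT.
Qed.

End ProductIdeals.

(** * Enumeration of the ideals, and the graph of the product ring *)

Lemma enum_card_eq (T : pointedType) (P : set T) t : P #= `I_t ->
  exists e : 'I_t -> T, injective e /\ forall x, P x <-> exists i, x = e i.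
Proof.
move=> /card_esym cP.
have /card_set_bijP[e [Pe e_inj e_surj]] := card_eq_trans (card_esym (@card_II t)) cP.
exists e; split=> [i k|x]; first by apply: e_inj; rewrite in_setT.
split=> [/e_surj[i _ <-]|[i ->]]; first by exists i.
exact: Pe.
Qed.

(** [None] indexes the whole ring and [Some i] the proper ideals. *)
Lemma enum_ideals (R : comNzRingType) t : [set I : set R | is_proper_ideal I] #= `I_t ->
  exists j : option 'I_t -> set R,
    [/\ injective j, forall I, is_ideal I <-> exists w, I = j w & j None = setT].
Proof.
move=> /enum_card_eq[e [e_inj eP]]; exists (fun w => if w is Some i then e i else setT).
have eT i : e i <> setT by have [_] := (eP (e i)).2 (ex_intro _ i erefl).
split=> //.
  by move=> [i|] [k|] //= => [/e_inj->//|/eT//|/esym/eT].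
move=> I; split=> [idI|[[i|] ->]]; last exact: is_ideal_setT.
  have [->|IT] := pselect (I = setT); first by exists None.
  by have [i ->] := (eP I).1 (conj idI IT); exists (Some i).
by have [] := (eP (e i)).2 (ex_intro _ i erefl).
Qed.

Section ProductGraph.
Local Open Scope ring_scope.
Variables (R1 R2 : comNzRingType) (W1 W2 : finType).
Variables (j1 : W1 -> set R1) (j2 : W2 -> set R2).
Hypotheses (idealE1 : forall I, is_ideal I <-> exists w, I = j1 w)
  (idealE2 : forall I, is_ideal I <-> exists w, I = j2 w).
Hypotheses (localR1 : local_ring R1) (localR2 : local_ring R2).

Let id1 w : is_ideal (j1 w). Proof. by apply/idealE1; exists w. Qed.
Let id2 w : is_ideal (j2 w). Proof. by apply/idealE2; exists w. Qed.
Let phi w := prod_ideal (j1 w.1) (j2 w.2).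

Lemma prod_ideal_enum_inj : injective j1 -> injective j2 -> injective phi.
Proof.
move=> j1_inj j2_inj [u1 u2] [v1 v2] E.
have [e1 e2] := prod_ideal_inj (id1 u1) (id2 u2) (id1 v1) (id2 v2) E.
by rewrite (j1_inj _ _ e1) (j2_inj _ _ e2).
Qed.

(** The annihilator is taken componentwise, and in each factor it vanishes only for the whole
    ring. *)
Lemma EG_vertices_prod w : EG_vertices (phi w) <->
  ~ (j1 w.1 = setT /\ j2 w.2 = setT) /\ ~ (j1 w.1 = [set 0] /\ j2 w.2 = [set 0]).
Proof.
have set00 : prod_ideal [set (0 : R1)] [set (0 : R2)] = [set 0].
  by apply/seteqP; split=> [[x y] [/= -> ->]|_ ->].
have inj0 (I : set R1) (J : set R2) : is_ideal I -> is_ideal J ->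
    prod_ideal I J = [set 0] <-> I = [set 0] /\ J = [set 0].
  move=> idI idJ; split=> [|[-> ->]]; last exact set00.
  rewrite -set00.
  exact: (prod_ideal_inj idI idJ (is_ideal_set0 R1) (is_ideal_set0 R2)).
have annE : Ann (phi w) = [set 0] <-> j1 w.1 = setT /\ j2 w.2 = setT.
  rewrite Ann_prod // inj0; try exact: is_ideal_Ann.
  by rewrite (Ann_eq0 idealE1 localR1 (id1 _)) (Ann_eq0 idealE2 localR2 (id2 _)).
have phi0 := inj0 _ _ (id1 w.1) (id2 w.2).
split=> [[[_ ann] nz]|[ann nz]]; first by split=> [/annE|/phi0].
split=> [|/phi0//]; split=> [|/annE//]; exact: is_ideal_prod.
Qed.

Lemma EG_adj_prod u v : EG_adj (phi u) (phi v) <->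
  [/\ EG_vertices (phi u), EG_vertices (phi v), phi u <> phi v,
      ~ (j1 u.1 = setT /\ j1 v.1 = setT) & ~ (j2 u.2 = setT /\ j2 v.2 = setT)].
Proof.
have essE : essential (Ann (ideal_mul (phi u) (phi v))) <->
    ~ (j1 u.1 = setT /\ j1 v.1 = setT) /\ ~ (j2 u.2 = setT /\ j2 v.2 = setT).
  rewrite Ann_mul_prod // essential_prod; try exact: is_ideal_Ann.
  by rewrite (essential_Ann_mul idealE1) // (essential_Ann_mul idealE2).
by split=> [[? ? ? /essE[? ?]]|[? ? ? ? ?]]; split=> //; apply/essE.
Qed.

Lemma EG_vertices_prodP K : EG_vertices K -> exists w, K = phi w.
Proof.
move=> [[/ideal_prodP[I [J [/idealE1[w1 ->] /idealE2[w2 ->] ->]]] _] _].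
by exists (w1, w2).
Qed.

End ProductGraph.

Theorem theorem2p7 (R1 R2 : comNzRingType) (t1 t2 : nat)
  (artinian_R1 : artinian R1) (local_R1 : local_ring R1)
  (artinian_R2 : artinian R2) (local_R2 : local_ring R2)
  (card_R1 : [set I : set R1 | is_proper_ideal I] #= `I_t1)
  (card_R2 : [set I : set R2 | is_proper_ideal I] #= `I_t2)
  (t1_ge2 : (2 <= t1)%N) (t2_ge2 : (2 <= t2)%N)
  (t1_even : ~~ odd t1) (t2_even : ~~ odd t2) :
  class2 (EG (R1 * R2)%type) <-> (t1 = 2%N /\ t2 = 2%N).
Proof.
have [j1 [j1_inj idealE1 j1T]] := enum_ideals card_R1.
have [j2 [j2_inj idealE2 j2T]] := enum_ideals card_R2.
have [z1 z1E] := (idealE1 _).1 (is_ideal_set0 R1).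
have [z2 z2E] := (idealE2 _).1 (is_ideal_set0 R2).
have z1N : z1 != None by apply/eqP => z1N; apply: (@setT_neq0 R1); rewrite z1E z1N j1T.
have z2N : z2 != None by apply/eqP => z2N; apply: (@setT_neq0 R2); rewrite z2E z2N j2T.
have topE1 w : j1 w = setT <-> w = None by rewrite -j1T; split=> [/j1_inj|->].
have topE2 w : j2 w = setT <-> w = None by rewrite -j2T; split=> [/j2_inj|->].
have botE1 w : j1 w = [set 0%R] <-> w = z1 by rewrite z1E; split=> [/j1_inj|->].
have botE2 w : j2 w = [set 0%R] <-> w = z2 by rewrite z2E; split=> [/j2_inj|->].
pose N1 : {set option 'I_t1} := finset.setC (finset.set1 None).
pose N2 : {set option 'I_t2} := finset.setC (finset.set1 None).
(* [A] stands for the ideals R1 x I2 and [B] for I1 x R2, with I1 and I2 proper, zero allowed. [C]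
   stands for the products of two proper ideals other than the zero ideal. *)
pose A := finset.setX (finset.set1 None : {set option 'I_t1}) N2.
pose B := finset.setX N1 (finset.set1 None : {set option 'I_t2}).
pose C := (finset.setX N1 N2 :\ (z1, z2))%SET.
have cN n : #|finset.setC (finset.set1 None : {set option 'I_n})| = n.
  have := cardsC (finset.set1 None : {set option 'I_n}).
  by rewrite cards1 card_option card_ord; lia.
have cA : #|A| = t2 by rewrite cardsX cards1 cN mul1n.
have cB : #|B| = t1 by rewrite cardsX cards1 cN muln1.
have cC : #|C| = (#|A| * #|B|).-1.
  have := cardsD1 (z1, z2) (finset.setX N1 N2); rewrite cardsX !cN cA cB.
  by rewrite finset.in_setX !finset.in_setC !finset.in_set1 z1N z2N /C mulnC => ->.
have memA u : (u \in A) = (u.1 == None) && (u.2 != None).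
  by case: u => u1 u2; rewrite finset.in_setX finset.in_setC !finset.in_set1.
have memB u : (u \in B) = (u.1 != None) && (u.2 == None).
  by case: u => u1 u2; rewrite finset.in_setX finset.in_setC !finset.in_set1.
have memC u : (u \in C) = [&& u != (z1, z2), u.1 != None & u.2 != None].
  by case: u => u1 u2; rewrite finset.in_setD1 finset.in_setX !finset.in_setC !finset.in_set1.
have DE u : (u \in A :|: B :|: C)%SET = ~~ ((u.1 == None) && (u.2 == None)) && (u != (z1, z2)).
  rewrite !finset.in_setU memA memB memC; case: u => u1 u2 /=.
  rewrite xpair_eqE.
  have [z1N' z2N'] : (None == z1) = false /\ (None == z2) = false.
    by rewrite ![None == _]eq_sym (negbTE z1N) (negbTE z2N).
  case: (eqVneq u1 None) => [->|_]; case: (eqVneq u2 None) => [->|_];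
    by rewrite /= ?z1N' ?z2N' ?andbF ?andbT ?orbF.
have vE w : EG_vertices (prod_ideal (j1 w.1) (j2 w.2)) <-> (w \in A :|: B :|: C)%SET.
  rewrite (EG_vertices_prod idealE1 idealE2 local_R1 local_R2) topE1 topE2 botE1 botE2 DE.
  case: w => w1 w2 /=; rewrite xpair_eqE; split=> [[nT n0]|/andP[/negP nT /negP n0]].
    by apply/andP; split; apply/negP => /andP[/eqP ? /eqP ?]; [apply: nT|apply: n0].
  by split=> -[/eqP ? /eqP ?]; [apply: nT|apply: n0]; apply/andP.
have -> : t1 = 2%N /\ t2 = 2%N <-> #|A| = 2%N /\ #|B| = 2%N by rewrite cA cB; tauto.
have phiI := prod_ideal_enum_inj idealE1 idealE2 j1_inj j2_inj.
apply: (@class2_multipartite _ _ _ (fun w => prod_ideal (j1 w.1) (j2 w.2)) A B C);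
  rewrite ?cA ?cB //.
- move=> K; split=> [KG|[w /vE ? ->] //].
  have [w Kw] := EG_vertices_prodP idealE1 idealE2 KG.
  by exists w => //; apply/vE; rewrite -Kw.
- move=> u v; apply: (iff_trans (EG_adj_prod idealE1 idealE2 local_R1 local_R2 u v)).
  split=> [[/vE uD /vE vD uv n1 n2]|/and5P[uD vD uv nA nB]].
    apply/and5P; split=> //; first by apply/eqP => e; apply: uv; rewrite e.
      rewrite !memA; apply/negP => /andP[/andP[/eqP ? _] /andP[/eqP ? _]].
      by apply: n1; split; apply/topE1.
    rewrite !memB; apply/negP => /andP[/andP[_ /eqP ?] /andP[_ /eqP ?]].
    by apply: n2; split; apply/topE2.
  split; [exact/vE|exact/vE|by move=> /phiI e; rewrite e eqxx in uv| |].
    (* Two vertices with first component R1 have proper second components, so both would lie in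
       [A]. *)
    move=> [/topE1 u1 /topE1 v1]; move: nA uD vD; rewrite !memA !DE u1 v1 eqxx /=.
    by case: (u.2 == None); case: (v.2 == None).
  move=> [/topE2 u2 /topE2 v2]; move: nB uD vD; rewrite !memB !DE u2 v2 eqxx !andbT.
  by case: (u.1 == None); case: (v.1 == None).
- rewrite -setI_eq0; apply/eqP/setP => u; rewrite finset.in_setI memA memB finset.in_set0.
  by case: (u.1 == None); rewrite ?andbF.
- rewrite -setI_eq0; apply/eqP/setP => u; rewrite finset.in_setI memA memC finset.in_set0.
  by case: (u.1 == None); rewrite ?andbF.
- rewrite -setI_eq0; apply/eqP/setP => u; rewrite finset.in_setI memB memC finset.in_set0.
  by case: (u.2 == None); rewrite ?andbF.
- by rewrite cC cA cB.
Qed.
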